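(* Let $\mathcal{G}^*$ be the class of connected graphs that have, counted with multiplicity, exactly two positive adjacency eigenvalues, exactly one adjacency eigenvalue less than $-1$, and all other adjacency eigenvalues equal to $-1$ or $0$. A graph $H$ belongs to $\mathcal{G}^*$ if and only if $H$ is (isomorphic to) one of the following: (i) a mixed extension of the path $P_3$ of type $(-p,-q,r)$, $(-p,q,r)$, $(p,-q,r)$, or $(p,q,r)$, with $p,q\geq 1$ and $r\geq 2$; (ii) a mixed extension of the path $P_4$ of type $(p,-3,-2,-2)$, $(-2,q,r,-2)$, or $(p,-2,r,-3)$, with $p,q,r\geq 1$; (iii) a mixed extension of $P_4$ of type $(p,q,-r,s)$, with $r\geq 1$ and $(p,q,s)\in\{(3,3,6),(3,4,4),(3,6,3),(4,2,6),(4,3,3),(4,6,2),(5,2,4),(5,4,2),(7,2,3),(7,3,2)\}$; (iv) a mixed extension of $P_4$ of type $(p,q,r,s)$, with $(p,q,r,s)\in\{(2,2,2,7),(2,2,3,4),(2,2,6,3),(2,3,2,5),(2,3,4,3),(2,5,2,4),(2,5,3,3),(3,2,2,3)\}$; (v) a mixed extension of the path $P_5$ of type $(1,p,-q,r,1)$ with $p,q,r\geq 1$. Here $p,q,r,s$ are integers.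
   Context: All graphs are finite, simple and undirected; eigenvalues of a graph are those of its adjacency matrix, counted with multiplicity. Mixed extension: let $G$ be a graph with vertex set $\{1,\ldots,n\}$ and let $(t_1,\ldots,t_n)$ be an $n$-tuple of nonzero integers. The mixed extension of $G$ of type $(t_1,\ldots,t_n)$ is the graph whose vertex set is the union of mutually disjoint sets $V_1,\ldots,V_n$ with $|V_i|=|t_i|$, where the vertices of $V_i$ are mutually adjacent (a clique) if $t_i>0$ and mutually nonadjacent (a coclique) if $t_i<0$, and where, for $i\neq j$, every vertex of $V_i$ is adjacent to every vertex of $V_j$ if $i$ and $j$ are adjacent in $G$, and no vertex of $V_i$ is adjacent to a vertex of $V_j$ otherwise. (The values $t_i=1$ and $t_i=-1$ both mean that $V_i$ is a single vertex.) The path $P_n$ has vertices $1,\ldots,n$ in their order along the path, so $i$ and $j$ are adjacent iff $|i-j|=1$. *)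

(* Defs.v *)
From HB Require Import structures.
From mathcomp Require Import all_boot all_order all_algebra all_field.

Set Implicit Arguments.
Unset Strict Implicit.
Unset Printing Implicit Defensive.

Import Order.TTheory GRing.Theory Num.Theory.
Local Open Scope ring_scope.

Record sgraph := SGraph {
  vertex :> finType;
  adj : rel vertex;
  adj_sym : symmetric adj;
  adj_irr : irreflexive adj
}.

Definition sg_iso (G H : sgraph) : Prop :=
  exists2 f : G -> H, bijective f & {mono f : x y / adj x y}.

Definition sg_connected (G : sgraph) : Prop :=
  forall x y : G, connect (@adj G) x y.

Definition adjmx (G : sgraph) : 'M[algC]_#|G| :=
  \matrix_(i, j) (adj (enum_val i) (enum_val j))%:R.

(* The roots of the characteristic polynomial, each repeated according to its
   multiplicity (see eigenvaluesP); the order of the sequence is unspecified. *)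
Definition eigenvalues n (A : 'M[algC]_n) : seq algC :=
  sval (closed_field_poly_normal (char_poly A)).

Lemma eigenvaluesP n (A : 'M[algC]_n) :
  char_poly A = \prod_(x <- eigenvalues A) ('X - x%:P).
Proof.
rewrite /eigenvalues; case: closed_field_poly_normal => s /= {1}->.
by rewrite (monicP (char_poly_monic A)) scale1r.
Qed.

(* On algC the order is partial: 0 < x and x < -1 both entail that x is real. *)
Definition in_Gstar (G : sgraph) : Prop :=
  let ev := eigenvalues (adjmx G) in
  [/\ sg_connected G,
      count (fun x => 0 < x) ev = 2%N,
      count (fun x => x < -1) ev = 1%N &
      all (fun x => [|| 0 < x, x < -1, x == -1 | x == 0]) ev].

(* The part V_i is the set of pairs (i, k) with k < |t i|.  Types are meant to
   have nonzero entries; t i = 0 would give an empty part. *)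
Definition mixed_vertex (G : sgraph) (t : G -> int) : finType :=
  {i : G & 'I_(absz (t i))}.

Definition mixed_adj (G : sgraph) (t : G -> int) : rel (mixed_vertex t) :=
  fun x y => if tag x == tag y then (x != y) && (0 < t (tag x))
             else adj (tag x) (tag y).

Lemma mixed_adj_sym (G : sgraph) (t : G -> int) : symmetric (@mixed_adj G t).
Proof.
move=> x y; rewrite /mixed_adj (eq_sym (tag y)) (eq_sym y) adj_sym.
by case: eqP => // ->.
Qed.

Lemma mixed_adj_irr (G : sgraph) (t : G -> int) : irreflexive (@mixed_adj G t).
Proof. by move=> x; rewrite /mixed_adj !eqxx. Qed.

Definition mixed_ext (G : sgraph) (t : G -> int) : sgraph :=
  SGraph (@mixed_adj_sym G t) (@mixed_adj_irr G t).

(* The vertices 1, ..., n of P_n are numbered 0, ..., n - 1 here. *)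
Definition path_adj (n : nat) : rel 'I_n :=
  fun i j => (i.+1 == j :> nat) || (j.+1 == i :> nat).

Lemma path_adj_sym (n : nat) : symmetric (@path_adj n).
Proof. by move=> i j; rewrite /path_adj orbC. Qed.

Lemma path_adj_irr (n : nat) : irreflexive (@path_adj n).
Proof. by move=> i; rewrite /path_adj orbb gtn_eqF. Qed.

Definition path_graph (n : nat) : sgraph :=
  SGraph (@path_adj_sym n) (@path_adj_irr n).

Definition mixed_path (n : nat) (t : n.-tuple int) : sgraph :=
  @mixed_ext (path_graph n) (tnth t).

(* Main.v *)
(** The class is detected by rank and signature: a connected graph with adjacency
    matrix A is in G* iff rank (A^2 + A) <= 3, A is positive definite on some
    plane and A + I is negative definite on some line.
    For a mixed extension A^2 + A is constant on blocks, and its rank is that of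
    Q (Q + 1) for the quotient matrix Q.  It is automatically at most 3 for P_3;
    for P_4 it is at most 3 iff det Q = 0 or det (Q + 1) = 0, which after
    division by the part sizes becomes an equation in unit fractions with
    finitely many solutions up to the free parameters of (ii)-(iv).
    Conversely, a graph of G* has no induced subgraph with three positive
    eigenvalues or with two eigenvalues less than -1.  Around an induced P_5,
    or P_4 (without P_5), or paw (without P_4), these exclusions leave a single
    way to attach every other vertex and to join any two of them, so the graph
    is a mixed extension of a path.  A connected graph with neither P_4 nor paw
    is complete multipartite and has only one positive eigenvalue. *)
Require Import Defs.
From HB Require Import structures.
From mathcomp Require Import all_boot all_order all_algebra all_field.
From mathcomp Require Import zify ring.

Set Implicit Arguments.
Unset Strict Implicit.
Unset Printing Implicit Defensive.

Import Order.TTheory GRing.Theory Num.Theory.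
Local Open Scope ring_scope.
Local Open Scope sesquilinear_scope.

(** * Inertia of the adjacency matrix *)

(** No spectrum is ever computed. Eigenvalue counts are bounded below by integer vectors: a family
    orthogonal for A, or for A + I, on an induced subgraph extends by zero to the whole graph. This
    takes the place of interlacing and turns every exclusion into a finite integer check. The rank
    makes the bounds exact: A^2 + A kills precisely the eigenvalues 0 and -1, so two positive
    eigenvalues and one below -1 use up a rank of three. The order P_5, P_4, paw lets each
    configuration, once ruled out, serve as forbidden subgraph for the next. The type is not unique:
    a single vertex is both clique and coclique, and the path can be read from either end, so a type
    found must still be brought into the listed form. *)

Lemma char_poly_conj (R : comUnitRingType) n (P D : 'M[R]_n) :
  P \in unitmx -> char_poly (invmx P *m D *m P) = char_poly D.
Proof.
move=> uP; rewrite /char_poly /char_poly_mx.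
have PK : map_mx polyC (invmx P) *m map_mx polyC P = 1%:M.
  by rewrite -map_mxM mulVmx // map_mx1.
rewrite !map_mxM.
have -> : 'X%:M - map_mx polyC (invmx P) *m map_mx polyC D *m map_mx polyC P
  = map_mx polyC (invmx P) *m ('X%:M - map_mx polyC D) *m map_mx polyC P.
  by rewrite mulmxBr mulmxBl scalar_mxC -(mulmxA 'X%:M) PK mulmx1.
by rewrite !det_mulmx mulrC mulrA -det_mulmx (mulmx1C PK) det1 mul1r.
Qed.

Lemma eigenvalues_spectral n (A : 'M[algC]_n) : A \is hermsymmx ->
  perm_eq (eigenvalues A) [seq spectral_diag A 0 i | i <- enum 'I_n].
Proof.
move=> /hermitian_normalmx/orthomx_spectralP defA; apply: prod_XsubC_eq.
rewrite -eigenvaluesP {1}defA char_poly_conj ?spectral_unit //.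
rewrite char_poly_trig ?diag_mx_is_trig // big_map big_enum /=.
by apply: eq_bigr => i _; rewrite !mxE eqxx.
Qed.

Lemma count_eigenvalues n (A : 'M[algC]_n) (a : pred algC) : A \is hermsymmx ->
  count a (eigenvalues A) = #|[pred i | a (spectral_diag A 0 i)]|.
Proof.
move=> /eigenvalues_spectral/permP->; rewrite count_map -size_filter cardE.
by rewrite enumT.
Qed.

(* A subspace on which a Hermitian form is positive definite meets trivially
   the span of the eigenvectors with nonpositive eigenvalues. *)
Lemma posdef_card n k (P : 'M[algC]_n) (d : 'rV[algC]_n)
    (U : 'M[algC]_(k, n)) (g : 'rV[algC]_k) :
  d \is a realmx ->
  U *m (P ^t* *m diag_mx d *m P) *m U ^t* = diag_mx g ->
  (forall i, 0 < g 0 i) -> (k <= #|[pred i | (0 < d 0 i)%R]|)%N.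
Proof.
move=> dR eqUg g_gt0; rewrite leqNgt; apply/negP => ltk.
pose S := [pred i | 0 < d 0 i].
pose W := \matrix_(i < k, j < #|S|) (U *m P ^t*) i (enum_val j).
have [c c0 cW] : exists2 c : 'rV_k, c != 0 & c *m W = 0.
  have /rowV0Pn[c /sub_kermxP cW c0] : kermx W != 0.
    rewrite kermx_eq0 -row_leq_rank -ltnNge.
    exact: leq_ltn_trans (rank_leq_col W) ltk.
  by exists c.
pose y := c *m U *m P ^t*.
have y0 i : 0 < d 0 i -> y 0 i = 0.
  move=> di; have Si : i \in S by [].
  have <- : (c *m W) 0 (enum_rank_in Si i) = 0 by rewrite cW mxE.
  rewrite /y -mulmxA !mxE; apply: eq_bigr => j _.
  by rewrite [W _ _]mxE enum_rankK_in.
have eqn : c *m diag_mx g *m c ^t* = y *m diag_mx d *m y ^t*.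
  rewrite -eqUg /y !trmx_mul !map_mxM !mulmxA.
  by rewrite trmxCK.
have := congr1 (fun M : 'M_1 => M 0 0) eqn.
have quad m (a e : 'rV[algC]_m) :
    (a *m diag_mx e *m a ^t*) 0 0 = \sum_i e 0 i * `|a 0 i| ^+ 2.
  rewrite mxE; apply: eq_bigr => i _.
  by rewrite mul_mx_diag !mxE normCK mulrAC mulrC mulrA.
rewrite !quad => eqs.
have : 0 < \sum_i g 0 i * `|c 0 i| ^+ 2.
  have /rV0Pn[i ci] := c0.
  rewrite (bigD1 i) //= ltr_pwDl ?mulr_gt0 ?exprn_gt0 ?normr_gt0 //.
  by apply: sumr_ge0 => j _; rewrite mulr_ge0 ?exprn_ge0 // ltW.
rewrite eqs lt_neqAle => /andP[nz]; apply/negP; move: nz.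
apply: contraNN => ge0.
rewrite eq_le ge0 /=; apply: sumr_le0 => i _.
have /mxOverP/(_ 0 i) di := dR.
have [/y0->|di_le0] := boolP (0 < d 0 i); first by rewrite normr0 expr0n mulr0.
by rewrite mulr_le0_ge0 ?exprn_ge0 // real_leNgt ?real0.
Qed.

(** The selection matrix [s] of the nonzero positions compresses the diagonal matrix to an
    invertible one and expands it back, so both have the same rank. *)
Lemma rank_diag_mx (F : fieldType) n (e : 'rV[F]_n) :
  \rank (diag_mx e) = #|[pred i | e 0 i != 0]|.
Proof.
pose S := [pred i | e 0 i != 0].
pose s : 'M[F]_(#|S|, n) := \matrix_(i, j) (enum_val i == j)%:R.
pose e' : 'rV[F]_#|S| := \row_i e 0 (enum_val i).
have eqe : s *m diag_mx e *m s^T = diag_mx e'.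
  apply/matrixP=> i j; rewrite mul_mx_diag !mxE (bigD1 (enum_val i)) //= !mxE.
  rewrite eqxx mul1r (inj_eq enum_val_inj) big1 => [|k /negPf ki].
    by rewrite addr0 eq_sym; case: eqP => [->|]; rewrite ?mulr1 ?mulr0.
  by rewrite !mxE eq_sym ki !mul0r.
have eqe' : s^T *m diag_mx e' *m s = diag_mx e.
  apply/matrixP=> i j; rewrite mul_mx_diag !mxE.
  have [Si|] := boolP (i \in S); last first.
    rewrite negbK => /eqP ei; rewrite ei mul0rn big1 // => k _; rewrite !mxE.
    case: eqP => [ki|_]; last by rewrite !mul0r.
    by have := enum_valP k; rewrite ki inE ei eqxx.
  rewrite (bigD1 (enum_rank_in Si i)) //= !mxE enum_rankK_in // eqxx mul1r.
  rewrite big1 => [|k ki]; first by rewrite addr0 mulr_natr.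
  rewrite !mxE; case: eqP => [ki'|_]; last by rewrite !mul0r.
  by case/eqP: ki; apply: enum_val_inj; rewrite enum_rankK_in.
apply/eqP; rewrite eqn_leq; apply/andP; split.
  rewrite -eqe' -mulmxA; apply: leq_trans (mxrankM_maxl _ _) _.
  exact: rank_leq_col.
have <- : \rank (diag_mx e') = #|S|.
  apply: mxrank_unit; rewrite unitmxE det_diag unitfE prodf_seq_neq0.
  by apply/allP=> i _; rewrite /= mxE; have := enum_valP i.
rewrite -eqe; apply: leq_trans (mxrankM_maxl _ _) _; exact: mxrankM_maxr.
Qed.

(** An eigenvalue x of A becomes x (x + 1), which vanishes exactly for x = 0 and x = -1. *)
Definition adjmx2 (G : sgraph) : 'M[algC]_#|G| := adjmx G *m adjmx G + adjmx G.

Section GraphSpectrum.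
Variable G : sgraph.
Local Notation A := (adjmx G).
Local Notation ev := (eigenvalues A).
Local Notation P := (spectralmx A).
Local Notation d := (spectral_diag A).

Lemma tr_adjmx : A^T = A.
Proof. by apply/matrixP=> i j; rewrite !mxE adj_sym. Qed.

Lemma adjmx_herm : A \is hermsymmx.
Proof.
apply: realsym_hermsym; last by apply/mxOverP=> i j; rewrite mxE realn.
by apply/is_hermitianmxP; rewrite expr0 scale1r map_mx_id // tr_adjmx.
Qed.

Let adjmxE : A = P ^t* *m diag_mx d *m P.
Proof.
rewrite -invmx_unitary ?spectral_unitarymx //.
exact/orthomx_spectralP/hermitian_normalmx/adjmx_herm.
Qed.

Let spec_real : d \is a realmx.
Proof. exact/hermitian_spectral_diag_real/adjmx_herm. Qed.

Let PK : P *m P ^t* = 1%:M.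
Proof. exact/unitarymxP/spectral_unitarymx. Qed.

Let KP : P ^t* *m P = 1%:M.
Proof. exact: mulmx1C PK. Qed.

(** A diagonal positive Gram matrix already forces the rows of [U] to be independent. *)
Lemma pos_family k (U : 'M[algC]_(k, #|G|)) (g : 'rV[algC]_k) :
  U *m A *m U ^t* = diag_mx g -> (forall i, 0 < g 0 i) ->
  (k <= count (fun x => (0 < x)%R) ev)%N.
Proof.
move=> eqU g_gt0; rewrite count_eigenvalues ?adjmx_herm //.
by apply: (@posdef_card _ _ P d U g); rewrite // -adjmxE.
Qed.

Lemma low_family k (U : 'M[algC]_(k, #|G|)) (g : 'rV[algC]_k) :
  U *m (A + 1%:M) *m U ^t* = diag_mx g -> (forall i, g 0 i < 0) ->
  (k <= count (fun x => (x < -1)%R) ev)%N.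
Proof.
move=> eqU g_lt0; rewrite count_eigenvalues ?adjmx_herm //.
(* Eigenvalues of -(A + I): positive exactly where those of A lie below -1. *)
pose e := - (d + const_mx 1).
have eE : P ^t* *m diag_mx e *m P = - (A + 1%:M).
  have -> : diag_mx e = - (diag_mx d + 1%:M).
    by rewrite -diag_const_mx -linearD -linearN.
  by rewrite mulmxN mulNmx mulmxDr mulmxDl mulmx1 KP -adjmxE.
have -> : #|[pred i | (d 0 i < -1)%R]| = #|[pred i | (0 < e 0 i)%R]|.
  by apply: eq_card => i; rewrite !inE !mxE oppr_gt0 -ltrBrDr sub0r.
apply: (@posdef_card _ _ P e U (- g)).
- apply/mxOverP=> i j; rewrite !mxE; have /mxOverP/(_ i j) di := spec_real.
  by rewrite rpredN rpredD // real1.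
- by rewrite eE mulmxN mulNmx eqU linearN.
- by move=> i; rewrite mxE oppr_gt0.
Qed.

Lemma rank_adjmx2 :
  \rank (adjmx2 G) = count (fun x => x * (x + 1) != 0) ev.
Proof.
rewrite count_eigenvalues ?adjmx_herm //.
pose e := \row_i (d 0 i * (d 0 i + 1)).
have eE : adjmx2 G = P ^t* *m diag_mx e *m P.
  have -> : diag_mx e = diag_mx d *m diag_mx d + diag_mx d.
    rewrite mulmx_diag -linearD; congr diag_mx; apply/rowP=> i.
    by rewrite !mxE mulrDr mulr1.
  rewrite mulmxDr mulmxDl -adjmxE /adjmx2; congr (_ + _).
  rewrite {1 2}adjmxE !mulmxA; congr (_ *m _); rewrite -!mulmxA; congr (_ *m _).
  by rewrite (mulmxA P) PK mul1mx.
have uP : P \in unitmx by rewrite spectral_unit.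
rewrite eE -mulmxA (eqmxMfull _ (_ : row_full (P ^t* ))).
  rewrite mxrankMfree ?row_free_unit // rank_diag_mx.
  by apply: eq_card => i; rewrite !inE mxE.
by rewrite row_full_unit -invmx_unitary ?unitmx_inv ?spectral_unitarymx.
Qed.

End GraphSpectrum.

Section GstarSpectrum.
Variable G : sgraph.
Local Notation ev := (eigenvalues (adjmx G)).

Let pos : pred algC := fun x => 0 < x.
Let low : pred algC := fun x => x < -1.
Let nz : pred algC := fun x => x * (x + 1) != 0.

Let pos_low_disj x : pos x -> ~~ low x.
Proof.
move=> x0; apply/negP => x1; have := lt_trans x1 (lt_trans (ltrN10 _) x0).
by rewrite ltxx.
Qed.

Let pos_low_nz x : pos x || low x -> nz x.
Proof.
rewrite /nz mulf_eq0 negb_or addr_eq0 => /orP[x0|x1].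
  by rewrite !(gt_eqF, x0) ?(lt_trans (ltrN10 _)).
by rewrite !(lt_eqF, x1) ?(lt_trans x1 (ltrN10 _)).
Qed.

Let count_pos_low s : (count pos s + count low s)%N = count (predU pos low) s.
Proof.
rewrite -count_predUI [X in (_ + X)%N](_ : _ = 0%N) ?addn0 //.
apply/eqP; rewrite -leqn0 leqNgt -has_count; apply/hasPn => x _ /=.
by apply/negP => /andP[/pos_low_disj/negP].
Qed.

Lemma rank_adjmx2_Gstar : in_Gstar G -> \rank (adjmx2 G) = 3%N.
Proof.
case=> _ np nl /allP allev; rewrite rank_adjmx2.
transitivity (count pos ev + count low ev)%N; last first.
  by rewrite [count pos _]np [count low _]nl.
rewrite count_pos_low; apply: eq_in_count => x /allev /=.
rewrite orbA -[(0 < x) || _]/(pos x || low x).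
have [pl _|_ /=] := boolP (pos x || low x); first exact: pos_low_nz.
by case/orP=> /eqP->; rewrite ?addNr ?mulr0 ?mul0r eqxx.
Qed.

(** Positive eigenvalues and those below -1 are disjoint sets counted by the rank; the bounds 2 + 1
    against 3 leave no slack, so both counts are exact and every other eigenvalue is 0 or -1. *)
Lemma Gstar_intro : sg_connected G -> (\rank (adjmx2 G) <= 3)%N ->
  (2 <= count pos ev)%N -> (1 <= count low ev)%N -> in_Gstar G.
Proof.
rewrite rank_adjmx2 => cG nz3 pos2 low1.
have sub : (count (predU pos low) ev <= count nz ev)%N.
  by apply: sub_count => x; apply: pos_low_nz.
have pl3 : (count pos ev + count low ev <= 3)%N.
  by rewrite count_pos_low (leq_trans sub).
have ep : count pos ev = 2%N.
  apply/eqP; rewrite eqn_leq pos2 andbT -(leq_add2r 1).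
  by rewrite (leq_trans _ pl3) ?leq_add2l.
have el : count low ev = 1%N.
  apply/eqP; rewrite eqn_leq low1 andbT -(leq_add2l 2).
  by rewrite (leq_trans _ pl3) ?leq_add2r.
have none : count (predC (predU pos low)) [seq x <- ev | nz x] = 0%N.
  have := count_predC (predU pos low) [seq x <- ev | nz x].
  rewrite count_filter size_filter (@eq_count _ _ (predU pos low)); last first.
    by move=> x /=; case: (boolP (pos x || low x)) => // /pos_low_nz ->.
  rewrite -count_pos_low ep el => eq3; apply/eqP; rewrite -leqn0.
  by rewrite -(leq_add2l 3) addn0 eq3.
split=> //; apply/allP=> x xev; apply: contraT => out.
have : (0 < count (predC (predU pos low)) [seq x <- ev | nz x])%N.
  rewrite -has_count; apply/hasP; exists x; last first.
    by apply: contra out => /orP[]; rewrite /pos /low => ->; rewrite ?orbT.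
  rewrite mem_filter xev andbT /nz mulf_eq0; apply: contra out => /orP[->|].
    by rewrite !orbT.
  by rewrite addr_eq0 => ->; rewrite !orbT.
by rewrite none.
Qed.

End GstarSpectrum.

(** * Certificates of inertia *)

(** Forms of concrete 0/1 matrices are evaluated on integer lists, so that [vm_compute] never meets
    [algC]. *)
Definition dotb (r : seq bool) (w : seq int) : int :=
  foldr (fun p a => if p.1 then p.2 + a else a) 0 (zip r w).

Definition dotz (v w : seq int) : int :=
  foldr (fun p a => p.1 * p.2 + a) 0 (zip v w).

Definition bform (M : seq (seq bool)) (v w : seq int) : int :=
  dotz v [seq dotb r w | r <- M].

Definition orth_family (M : seq (seq bool)) (ws : seq (seq int))
    (a : pred int) : bool :=
  all (fun i => all (fun j =>
    let b := bform M (nth [::] ws i) (nth [::] ws j) in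
    if i == j then a b else b == 0) (iota 0 (size ws))) (iota 0 (size ws)).

Definition relmat (T : Type) (r : rel T) (s : seq T) : seq (seq bool) :=
  [seq [seq r x y | y <- s] | x <- s].

Lemma size_relmat (T : Type) (r : rel T) s M :
  relmat r s = M -> size s = size M.
Proof. by move=> <-; rewrite size_map. Qed.

Section Forms.
Variable G : sgraph.
Local Notation ev := (eigenvalues (adjmx G)).

Definition rmx (r : rel G) : 'M[algC]_#|G| :=
  \matrix_(i, j) (r (enum_val i) (enum_val j))%:R.

Definition lincomb (s : seq G) (w : seq int) : 'rV[algC]_#|G| :=
  \sum_(p <- zip w s) p.1%:~R *: delta_mx 0 (enum_rank p.2).

Lemma rmx_lincomb (r : rel G) s w x :
  (rmx r *m (lincomb s w) ^t* ) (enum_rank x) 0 =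
  (dotb [seq r x y | y <- s] w)%:~R.
Proof.
rewrite /lincomb /dotb; elim: w s => [|a w IHw] [|y s] /=; rewrite ?big_nil.
- by rewrite linear0 map_mx0 mulmx0 mxE.
- by rewrite linear0 map_mx0 mulmx0 mxE.
- by rewrite linear0 map_mx0 mulmx0 mxE.
rewrite big_cons linearD map_mxD mulmxDr mxE IHw /=.
have eqv (c : algC) : (c *: delta_mx 0 (enum_rank y) : 'rV[algC]_#|G|) ^t* =
    c^* *: delta_mx (enum_rank y) 0.
  by apply/matrixP=> i j; rewrite !mxE rmorphM rmorph_nat andbC.
rewrite eqv -scalemxAr mxE -colE !mxE !enum_rankK rmorph_int.
by case: (r x y); rewrite ?mulr1 ?mulr0 ?rmorphD ?add0r.
Qed.

Lemma lincomb_form (r : rel G) s v w :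
  (lincomb s v *m rmx r *m (lincomb s w) ^t* ) 0 0 =
  (bform (relmat r s) v w)%:~R.
Proof.
rewrite -mulmxA /bform /relmat /dotz {1}/lincomb.
have : forall s', (\sum_(p <- zip v s')
    p.1%:~R *: (delta_mx 0 (enum_rank p.2) : 'rV_#|G|) *m
    (rmx r *m (lincomb s w) ^t* )) 0 0 =
   (foldr (fun p a => p.1 * p.2 + a) 0
      (zip v [seq dotb r0 w | r0 <- [seq [seq r x y | y <- s] | x <- s']]))%:~R
   :> algC.
  elim: v => [|a v IHv] [|x s'] /=; try by rewrite big_nil mxE.
  rewrite big_cons mxE IHv rmorphD rmorphM /= -scalemxAl mxE -rowE mxE.
  by rewrite rmx_lincomb.
by rewrite mulmx_suml.
Qed.

Definition family (s : seq G) (ws : seq (seq int)) : 'M[algC]_(size ws, #|G|) :=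
  \matrix_(i < size ws) lincomb s (nth [::] ws i).

Lemma orth_familyP (r : rel G) s ws a : orth_family (relmat r s) ws a ->
  let q i := bform (relmat r s) (nth [::] ws i) (nth [::] ws i) in
  family s ws *m rmx r *m (family s ws) ^t* = diag_mx (\row_i (q i)%:~R) /\
  forall i : 'I_(size ws), a (q i).
Proof.
move=> /allP orth q; split=> [|i]; last first.
  have /orth/allP/(_ i) : (i : nat) \in iota 0 (size ws) by rewrite mem_iota /=.
  by rewrite mem_iota /= eqxx; apply.
apply/matrixP=> i j; transitivity
  ((lincomb s (nth [::] ws i) *m rmx r *m (lincomb s (nth [::] ws j)) ^t* )
     0 0).
  rewrite -!mulmxA !mxE; apply: eq_bigr => k _; rewrite !mxE; congr (_ * _).
  by apply: eq_bigr => l _; rewrite !mxE.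
rewrite lincomb_form !mxE.
have /orth/allP/(_ j) : (i : nat) \in iota 0 (size ws) by rewrite mem_iota /=.
rewrite mem_iota /= ltn_ord => /(_ isT).
by rewrite -val_eqE; case: eqP => [->|_ /eqP->].
Qed.

Lemma orth_family_pos s ws : orth_family (relmat (@adj G) s) ws (> 0) ->
  (size ws <= count (fun x => (0 < x)%R) ev)%N.
Proof.
move=> /orth_familyP[eqd q0]; apply: pos_family eqd _ => i.
by rewrite mxE ltr0z.
Qed.

Definition adj1 : rel G := fun x y => adj x y || (x == y).

Lemma orth_family_low s ws : orth_family (relmat adj1 s) ws (< 0) ->
  (size ws <= count (fun x => (x < -1)%R) ev)%N.
Proof.
move=> /orth_familyP[eqd q0].
have eA : rmx adj1 = adjmx G + 1%:M.
  apply/matrixP=> i j; rewrite !mxE /adj1 (inj_eq enum_val_inj).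
  by case: eqP => [->|_]; rewrite ?adj_irr ?add0r // orbF addr0.
rewrite eA in eqd; apply: low_family eqd _ => i; rewrite mxE ltrz0; exact: q0.
Qed.

End Forms.

(* Coefficient vectors, indexed by the vertices of a small graph: an orthogonal
   family for A of positive vectors, one for A + I of negative vectors, or the
   positions at which the forbidden graph F is induced. *)
Inductive certificate :=
  | PosCert of seq (seq int)
  | LowCert of seq (seq int)
  | SubCert of seq nat.

Definition entry (M : seq (seq bool)) i j := nth false (nth [::] M i) j.

Definition submat (M : seq (seq bool)) (l : seq nat) :=
  [seq [seq entry M i j | j <- l] | i <- l].

Definition addI (M : seq (seq bool)) :=
  [seq [seq entry M i j || (i == j) | j <- iota 0 (size M)]
     | i <- iota 0 (size M)].

(** Three positive vectors or two low ones: one more than G* allows. Vectors are written for the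
    base with two added vertices; when only one is added, [zip] drops the last coordinate. *)
Definition valid (F M : seq (seq bool)) (c : certificate) : bool :=
  match c with
  | PosCert ws => (2 < size ws)%N && orth_family M ws (> 0)
  | LowCert ws => (1 < size ws)%N && orth_family (addI M) ws (< 0)
  | SubCert l => [&& uniq l, all (fun i => i < size M)%N l & submat M l == F]
  end.

Definition excluded F cs M := has (valid F M) cs.

(* The adjacency matrix M extended by a last vertex with adjacencies p. *)
Definition ext1 (M : seq (seq bool)) (p : bitseq) :=
  rcons [seq rcons z.1 z.2 | z <- zip M p] (rcons p false).

Definition ext2 M p q a := ext1 (ext1 M p) (rcons q a).

Fixpoint bitseqs n : seq bitseq :=
  if n is n'.+1 then
    [seq true :: p | p <- bitseqs n'] ++ [seq false :: p | p <- bitseqs n']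
  else [:: [::]].

Lemma mem_bitseqs p : p \in bitseqs (size p).
Proof.
elim: p => //= -[] p IHp; rewrite mem_cat; apply/orP; [left|right];
  exact: map_f.
Qed.

Lemma entry_relmat (T : Type) (r : rel T) x0 s i j :
  (i < size s)%N -> (j < size s)%N ->
  entry (relmat r s) i j = r (nth x0 s i) (nth x0 s j).
Proof.
by move=> lti ltj; rewrite /entry (nth_map x0) // (nth_map x0).
Qed.

Lemma submat_relmat (T : Type) (r : rel T) x0 s l :
  all (fun i => i < size s)%N l ->
  submat (relmat r s) l = relmat r [seq nth x0 s i | i <- l].
Proof.
move=> /allP ltl; rewrite /submat /relmat -map_comp; apply/eq_in_map => i li /=.
rewrite -map_comp; apply/eq_in_map => j lj /=.
by rewrite (entry_relmat _ x0) ?ltl.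
Qed.

Section Tame.
Variable G : sgraph.
Local Notation amat := (relmat (@adj G)).

Definition patt (b : seq G) (x : G) : bitseq := [seq adj x z | z <- b].

Lemma addI_amat s : uniq s -> addI (amat s) = relmat (@adj1 G) s.
Proof.
case: s => [|x0 s0] //; move: (x0 :: s0) => s us.
rewrite /addI -[in RHS](mkseq_nth x0 s) /mkseq /relmat -map_comp size_map.
apply/eq_in_map => i; rewrite mem_iota => /= lti.
rewrite -map_comp; apply/eq_in_map => j; rewrite mem_iota => /= ltj.
by rewrite (entry_relmat _ x0) // /adj1 nth_uniq.
Qed.

Lemma amat_rcons b x : amat (rcons b x) = ext1 (amat b) (patt b x).
Proof.
rewrite /ext1 /relmat map_rcons map_rcons adj_irr; congr rcons.
rewrite /patt zip_map -map_comp; apply: eq_map => y /=.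
by rewrite map_rcons adj_sym.
Qed.

Lemma patt_rcons b x y : patt (rcons b x) y = rcons (patt b y) (adj x y).
Proof. by rewrite /patt map_rcons adj_sym. Qed.

Definition tame (F : seq (seq bool)) : Prop :=
  [/\ (count (fun x => (0 < x)%R) (eigenvalues (adjmx G)) <= 2)%N,
      (count (fun x => (x < -1)%R) (eigenvalues (adjmx G)) <= 1)%N &
      forall s : seq G, uniq s -> amat s <> F].

Lemma tame_excluded F cs s : tame F -> uniq s -> excluded F cs (amat s) = false.
Proof.
move=> [pos2 low1 noF] us.
rewrite /excluded; elim: cs => //= c cs ->; rewrite orbF.
apply/negbTE; case: c => [ws|ws|l] /=.
- apply/negP => /andP[lt2 /orth_family_pos/leq_trans/(_ pos2)].
  by rewrite leqNgt lt2.
- rewrite addI_amat //.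
  apply/negP => /andP[lt1 /orth_family_low/leq_trans/(_ low1)].
  by rewrite leqNgt lt1.
apply/negP => /and3P[ul]; case: s us => [|x0 s] us; rewrite size_map => ltl.
  by case: l ul ltl => // _ _ /eqP eF; apply: (noF [::]).
rewrite (submat_relmat _ x0) // => /eqP; apply: noF.
by rewrite map_inj_in_uniq // => i j /(allP ltl) ? /(allP ltl) ? /eqP;
  rewrite nth_uniq // => /eqP.
Qed.

End Tame.

(** * From adjacency patterns to labellings *)

Definition padj (i j : nat) : bool := (i.+1 == j) || (j.+1 == i).

(* M is the adjacency matrix of a base graph b, whose first k vertices represent
   the k classes.  The pattern of a vertex is its row of adjacencies to b; T lists
   the patterns allowed outside b, and tab gives the class of each pattern. *)
Section Labelling.
Variables (F M : seq (seq bool)) (k : nat) (tab : seq (bitseq * nat)).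
Variables (T : seq bitseq) (cs : seq certificate).

Local Notation m := (size M).
Local Notation row := (nth [::] M).
Local Notation excl := (excluded F cs).

(** A pattern missing from [tab] gets class 0 by default; this is harmless, since the checks test
    the labels actually produced. *)
Definition lab (p : bitseq) : nat :=
  nth 0%N (unzip2 tab) (index p (unzip1 tab)).

(* Within a class, two vertices are adjacent iff either of them is adjacent to
   the representative, so that the class is a clique or a coclique. *)
Definition consistent (p q : bitseq) (a : bool) : bool :=
  if lab p == lab q then
    (a == nth false p (lab p)) && (a == nth false q (lab q))
  else a == padj (lab p) (lab q).

Definition label_check : bool :=
  all (fun p => lab p < k)%N (M ++ T) &&
  all (fun i => lab (row i) == i) (iota 0 k).

(** The zero pattern cannot be excluded locally; [closed_check] and connectedness dispose of it. *)
Definition pattern_check : bool :=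
  all (fun p => [|| p \in T, p == nseq m false | excl (ext1 M p)]) (bitseqs m).

(* No vertex without neighbours in b is adjacent to a vertex having some, so by
   connectedness every vertex outside b has a pattern in T. *)
Definition closed_check : bool :=
  all (fun p => excl (ext2 M (nseq m false) p true)) T.

(** Both orders of the two added vertices are tried, so a certificate found for one order serves the
    other. *)
Definition pair_check : bool :=
  all (fun p => all (fun q => all (fun a =>
    [|| consistent p q a, excl (ext2 M p q a) | excl (ext2 M q p a)])
    [:: true; false]) T) T.

(** Concerns base vertices that represent no class. Only the paw has one, its last vertex, a second
    member of class 2. *)
Definition extra_check : bool :=
  all (fun j =>
    all (fun p => consistent (row j) p (nth false p j)) T &&
    all (fun i => (i == j) || consistent (row i) (row j) (entry M i j))
      (iota k (m - k)))
    (iota k (m - k)).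

Definition rep_check : bool :=
  all (fun p => all (fun i =>
    (lab p == i) || (nth false p i == padj (lab p) i)) (iota 0 k)) (M ++ T).

Definition labelling_check : bool :=
  [&& (0 < k <= m)%N, label_check, pattern_check, closed_check, pair_check,
      extra_check & rep_check].

Lemma consistentC p q a : consistent p q a = consistent q p a.
Proof.
rewrite /consistent eq_sym; case: eqP => [->|_]; first by rewrite andbC.
by rewrite /padj orbC.
Qed.

Variables (G : sgraph) (b : seq G) (x0 : G).
Hypotheses (tG : tame G F) (cG : sg_connected G) (ub : uniq b).
Hypotheses (bM : relmat (@adj G) b = M) (ok : labelling_check).

Let f (x : G) : nat := lab (patt b x).
Let rep (i : nat) : G := nth x0 b i.

Let size_b : size b = m.
Proof. by rewrite -bM size_map. Qed.

Let patt_row j : (j < m)%N -> patt b (rep j) = row j.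
Proof. by rewrite -size_b -bM => ltj; rewrite (nth_map x0). Qed.

Let nth_patt x j : (j < m)%N -> nth false (patt b x) j = adj x (rep j).
Proof. by rewrite -size_b => ltj; rewrite (nth_map x0). Qed.

Let mem_b x : x \in b -> exists2 j, (j < m)%N & x = rep j.
Proof.
by move=> xb; exists (index x b); rewrite ?/rep ?nth_index // -size_b index_mem.
Qed.

Let not_excl1 x : x \notin b -> excl (ext1 M (patt b x)) = false.
Proof.
move=> xb; rewrite -bM -amat_rcons; apply: tame_excluded => //.
by rewrite rcons_uniq xb.
Qed.

Let not_excl2 x y : x \notin b -> y \notin b -> x != y ->
  excl (ext2 M (patt b x) (patt b y) (adj x y)) = false.
Proof.
move=> xb yb xy; rewrite /ext2 -bM -amat_rcons -patt_rcons -amat_rcons.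
apply: tame_excluded => //.
by rewrite !rcons_uniq mem_rcons inE negb_or eq_sym xy xb yb ub.
Qed.

Let kP : (0 < k)%N /\ (k <= m)%N.
Proof. by case/and3P: ok => /andP. Qed.

Let pattern_mem x : x \notin b ->
  (patt b x \in T) || (patt b x == nseq m false).
Proof.
move=> xb; have inb : patt b x \in bitseqs m.
  by have := mem_bitseqs (patt b x); rewrite size_map size_b.
by case/and4P: ok => _ _ /allP/(_ _ inb) + _; rewrite not_excl1 // orbF.
Qed.

(** The vertices of [b] or with pattern in [T] form a set closed under adjacency: an edge leaving it
    would end in a vertex with zero pattern. *)
Let patternT x : x \notin b -> patt b x \in T.
Proof.
pose X := [pred x | (x \in b) || (patt b x \in T)].
suff cX : closed (@adj G) X.
  have : x \in X; last by move=> /orP[->|].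
  rewrite -(closed_connect cX (cG (rep 0) x)) inE mem_nth //.
  by rewrite size_b; case: kP => /leq_trans; apply.
have half y z : adj y z -> y \in X -> z \in X.
  move=> yz; rewrite !inE => Xy; have [//|zb] := boolP (z \in b).
  have /orP[//|/eqP z0] := pattern_mem zb.
  have [yb|yb] := boolP (y \in b).
    have [j ltj yj] := mem_b yb; have := nth_patt z ltj.
    by rewrite z0 nth_nseq if_same -yj adj_sym yz.
  rewrite (negPf yb) /= in Xy.
  have zny : z != y by apply: contraTneq yz => ->; rewrite adj_irr.
  have := not_excl2 zb yb zny; rewrite adj_sym yz z0.
  by case/and5P: ok => _ _ _ /allP/(_ _ Xy) ->.
move=> y z yz; apply/idP/idP; apply: half => //; by rewrite adj_sym.
Qed.

Let patt_mem x : patt b x \in M ++ T.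
Proof.
rewrite mem_cat; have [xb|xb] := boolP (x \in b); last first.
  by rewrite patternT ?orbT.
by have [j ltj ->] := mem_b xb; rewrite patt_row // mem_nth.
Qed.

Let f_lt x : (f x < k)%N.
Proof. by case/and3P: ok => _ /andP[/allP/(_ _ (patt_mem x))]. Qed.

Let lt_km i : (i < k)%N -> (i < m)%N.
Proof. by case: kP => _ lekm /leq_trans->. Qed.

Let f_rep i : (i < k)%N -> f (rep i) = i.
Proof.
move=> ltk; rewrite /f patt_row ?lt_km //; case/and3P: ok => _ /andP[_].
by move=> /allP/(_ i); rewrite mem_iota => /(_ ltk)/eqP.
Qed.

Let adj_rep x i : (i < k)%N -> f x != i -> adj x (rep i) = padj (f x) i.
Proof.
move=> ltk ne; case/and5P: ok => _ _ _ _ /and3P[_ _].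
move=> /allP/(_ _ (patt_mem x))/allP/(_ i).
rewrite mem_iota ltk => /(_ isT); rewrite (negPf ne) nth_patt ?lt_km //.
by move/eqP.
Qed.

Let not_rep x : x != rep (f x) -> x \in b ->
  exists2 j, (k <= j < m)%N & x = rep j.
Proof.
move=> ne /mem_b[j ltj xj]; exists j => //; rewrite ltj andbT leqNgt.
by apply: contra ne => ltk; rewrite {1}xj xj f_rep.
Qed.

(** Representatives are set aside because their own entry is [false], which says nothing about the
    sign of the class. *)
Let nonrep_consistent x y : x != rep (f x) -> y != rep (f y) -> x != y ->
  consistent (patt b x) (patt b y) (adj x y).
Proof.
case/and5P: ok => _ _ _ _ /and3P[ck2 /allP ck3 _].
have half u v : u != rep (f u) -> v \notin b -> u \in b ->
    consistent (patt b u) (patt b v) (adj u v).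
  move=> nu vb /(not_rep nu)[j /andP[lekj ltj] uj].
  have /ck3/andP[/allP/(_ _ (patternT vb))] : j \in iota k (m - k).
    by rewrite mem_iota lekj subnKC //; case: kP.
  by rewrite nth_patt // adj_sym uj patt_row.
move=> nx ny xy; have [xb|xb] := boolP (x \in b); last first.
  have [yb|yb] := boolP (y \in b); first by rewrite consistentC adj_sym half.
  have /orP[//|] : consistent (patt b x) (patt b y) (adj x y) || false.
    have /allP/(_ _ (patternT xb))/allP/(_ _ (patternT yb)) := ck2.
    move/allP/(_ (adj x y)).
    rewrite not_excl2 // (adj_sym x) not_excl2 // 1?eq_sym //.
    by rewrite !inE; case: (adj y x); apply.
  by [].
have [yb|yb] := boolP (y \in b); last exact: half.
have [i ltki xi] := not_rep nx xb; have [j ltkj yj] := not_rep ny yb.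
have memi h : (k <= h < m)%N -> h \in iota k (m - k).
  by rewrite mem_iota subnKC //; case: kP.
have /andP[_ /allP/(_ _ (memi _ ltki))] := ck3 _ (memi _ ltkj).
have /andP[_ lti] := ltki; have /andP[_ ltj] := ltkj.
rewrite -bM (entry_relmat _ x0) ?size_b // bM -/(rep i) -/(rep j).
rewrite -!patt_row // -xi -yj; case/orP => // /eqP ij.
by move: xy; rewrite xi yj ij eqxx.
Qed.

Let g (x : G) : bool := adj x (rep (f x)).

Let same_class x y : x != rep (f x) -> y != rep (f y) -> x != y -> f x = f y ->
  adj x y = g x /\ adj x y = g y.
Proof.
move=> nx ny xy fxy; have := nonrep_consistent nx ny xy.
rewrite /consistent -/(f x) -/(f y) fxy eqxx !nth_patt ?lt_km ?f_lt //.
by rewrite /g fxy => /andP[/eqP ? /eqP].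
Qed.

(** Sign of a class, read off any vertex other than the representative; [false] by default when
    there is none. *)
Let sg (i : nat) : bool := [exists x, (x != rep i) && (f x == i) && g x].

Let sgE x : x != rep (f x) -> sg (f x) = g x.
Proof.
move=> nx; apply/existsP/idP => [[y /andP[/andP[ny /eqP fy] gy]]|gx].
  have [-> //|xy] := eqVneq x y.
  by rewrite -fy in ny; have [<- ->] := same_class nx ny xy (esym fy).
by exists x; rewrite nx eqxx.
Qed.

(** The last two clauses give access to the tables: they locate the base vertices and read the sign
    of a class off the pattern of any of its vertices outside [b]. *)
Lemma labellingP : exists (h : G -> nat) (s : nat -> bool),
  [/\ forall x, (h x < k)%N,
      forall x y, h x != h y -> adj x y = padj (h x) (h y),
      forall x y, x != y -> h x = h y -> adj x y = s (h x),
      forall j, (j < m)%N -> h (nth x0 b j) = lab (row j) &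
      forall x, x \notin b -> exists2 p, p \in T &
        lab p = h x /\ nth false p (h x) = s (h x)].
Proof.
exists f, sg; split.
- exact: f_lt.
- move=> x y ne.
  have [->|nx] := eqVneq x (rep (f x)).
    rewrite adj_sym adj_rep ?f_lt ?f_rep ?f_lt // 1?eq_sym //.
    by rewrite /padj orbC.
  have [->|ny] := eqVneq y (rep (f y)).
    by rewrite adj_rep ?f_lt ?f_rep ?f_lt.
  have xy : x != y by apply: contraNneq ne => ->.
  have := nonrep_consistent nx ny xy.
  by rewrite /consistent -/(f x) -/(f y) (negPf ne) => /eqP.
- move=> x y xy fxy.
  have [xr|nx] := eqVneq x (rep (f x)).
    have ny : y != rep (f y) by rewrite -fxy -xr eq_sym.
    by rewrite fxy sgE // /g -fxy -xr adj_sym.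
  have [yr|ny] := eqVneq y (rep (f y)).
    by rewrite sgE // /g fxy -yr.
  by rewrite sgE //; case: (same_class nx ny xy fxy).
- by move=> j ltj; rewrite -patt_row.
move=> x xb; exists (patt b x); first exact: patternT.
split=> //; rewrite nth_patt ?lt_km ?f_lt // sgE //.
apply: contraNneq xb => ->; rewrite mem_nth // size_b; exact/lt_km/f_lt.
Qed.

End Labelling.

Definition path_mat (n : nat) : seq (seq bool) := relmat padj (iota 0 n).

(** Pendant vertex 0 attached to the triangle 1, 2, 3: the mixed extension of P_3 of type (1, 1,
    2). *)
Definition paw_adj (i j : nat) : bool :=
  padj i j || ((i, j) \in [:: (1, 3); (3, 1)]%N).

Definition paw_mat : seq (seq bool) := relmat paw_adj (iota 0 4).

(** * Induced P_5, P_4 and paw *)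

(** A closed twin of vertex 3, an open twin of 2, a closed twin of 1: hence the shape (1, p, -q, r,
    1). *)
Definition P5_patterns : seq bitseq :=
  [:: [:: false; false; true; true; true];
      [:: false; true; false; true; false];
      [:: true; true; true; false; false]].

Definition P5_labels : seq (bitseq * nat) :=
  [:: ([:: false; true; false; false; false], 0%N);
      ([:: true; false; true; false; false], 1%N);
      ([:: false; true; false; true; false], 2%N);
      ([:: false; false; true; false; true], 3%N);
      ([:: false; false; false; true; false], 4%N);
      ([:: false; false; true; true; true], 3%N);
      ([:: true; true; true; false; false], 1%N)].

(* The vectors of the certificates were found by a computer search over small
   integer coefficients; only their orthogonality and signs are used. *)
Definition P5_certificates : seq certificate :=
  [:: LowCert [:: [:: 0; 1; -1; 1; 0; 0; 0]; [:: 1; 0; 0; 1; 0; -1; 0]];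
      LowCert [:: [:: 0; 1; 0; 0; 1; -1; 0]; [:: 1; -1; 1; 0; 1; -1; 0]];
      LowCert [:: [:: 1; -1; 1; 0; 0; 0; 0]; [:: 1; 0; -1; 2; -2; -1; 0]];
      LowCert [:: [:: 1; -1; -1; 2; -2; 0; 0]; [:: 1; -2; 2; -1; 0; 1; 0]];
      LowCert [:: [:: 0; 1; 0; 0; 0; 1; -1]; [:: 0; 1; -1; 1; 0; 0; 0]];
      LowCert [:: [:: 1; -1; 1; 0; 0; 0; 0]; [:: 1; -1; 0; 1; -1; -1; 0]];
      LowCert [:: [:: 0; 0; 1; -1; 1; 0; 0]; [:: 1; -1; 0; 1; -1; 1; 0]];
      PosCert [:: [:: 1; 1; 0; -1; 0; 0; 0]; [:: 0; 0; 1; 1; 0; 1; 1];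
        [:: 0; 0; 1; 1; 0; -1; -1]];
      PosCert [:: [:: 1; 0; 0; 0; 1; 1; 0]; [:: 1; 1; -1; -1; 0; 0; 0];
        [:: 0; 1; 1; 1; -1; -1; 0]];
      LowCert [:: [:: 0; 0; 0; 1; 0; 1; -1]; [:: 0; 0; 1; -1; 1; 0; 0]];
      LowCert [:: [:: 0; 0; 0; 1; -1; -1; 0]; [:: 0; 1; -1; 0; 0; 1; 0]];
      LowCert [:: [:: 0; 0; 0; 1; 0; -1; -1]; [:: 0; 1; -1; 1; 0; 0; 0]];
      LowCert [:: [:: 0; 1; 0; 0; 0; -1; -1]; [:: 0; 1; -1; 1; 0; 0; 0]];
      LowCert [:: [:: 0; 0; 0; 1; 0; -1; -1]; [:: 0; 0; 1; 0; 1; -1; 0]];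
      LowCert [:: [:: 0; 1; 0; 0; 0; -1; -1]; [:: 1; 0; 1; 0; 0; 0; -1]];
      LowCert [:: [:: 0; 0; 1; -1; 0; -1; 0]; [:: 1; -1; 0; 0; 0; 1; 0]];
      PosCert [:: [:: 1; 1; 0; 0; 0; 0; 0]; [:: 0; 1; 0; 0; -1; -1; 0];
        [:: 1; 0; -1; -1; 0; 0; 0]];
      PosCert [:: [:: 0; 0; 0; 1; 1; 0; 0]; [:: 1; 1; 0; 0; 0; 0; 0];
        [:: 1; 0; -1; 0; 1; -1; 0]];
      PosCert [:: [:: 0; 0; 0; 1; 1; 0; 0]; [:: 1; 0; 0; 0; 0; 1; 0];
        [:: 0; 1; 1; 0; -1; -1; 0]];
      PosCert [:: [:: 0; 0; 0; 1; 1; 0; 0]; [:: 0; 1; 1; 0; -1; 0; 0];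
        [:: 0; 0; 2; 0; 0; -1; -1]];
      PosCert [:: [:: 0; 1; 0; 0; 1; 1; 0]; [:: 0; 0; 2; 0; -1; -1; 0];
        [:: 3; 0; -1; -1; 0; 0; 0]];
      PosCert [:: [:: 1; 0; 0; 1; 1; 0; 0]; [:: 2; 1; -1; 0; 0; 0; 0];
        [:: 1; 0; -1; 0; 2; -1; 0]];
      PosCert [:: [:: 0; 0; 1; -1; -2; 0; 0]; [:: 1; 0; -1; 0; 1; 1; 0];
        [:: 0; 1; 2; 0; -1; -1; 0]]]%Z.

(** Open and closed twins of all four vertices: the signs stay free here and are settled by
    arithmetic. *)
Definition P4_patterns : seq bitseq :=
  [:: [:: false; false; true; false];
      [:: false; false; true; true];
      [:: false; true; false; false];
      [:: false; true; false; true];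
      [:: false; true; true; true];
      [:: true; false; true; false];
      [:: true; true; false; false];
      [:: true; true; true; false]].

Definition P4_labels : seq (bitseq * nat) :=
  [:: ([:: false; true; false; false], 0%N);
      ([:: true; false; true; false], 1%N);
      ([:: false; true; false; true], 2%N);
      ([:: false; false; true; false], 3%N);
      ([:: false; false; true; true], 3%N);
      ([:: false; true; true; true], 2%N);
      ([:: true; true; false; false], 0%N);
      ([:: true; true; true; false], 1%N)].

Definition P4_certificates : seq certificate :=
  [:: LowCert [:: [:: 0; 1; -1; 0; 2; -1]; [:: 2; -1; 0; 0; 1; -1]];
      LowCert [:: [:: 0; 0; 1; -1; 0; -1]; [:: 0; 1; 0; 0; -1; -1]];
      LowCert [:: [:: 0; 0; 1; 0; 1; -1]; [:: 0; 1; -1; 1; 1; -1]];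
      LowCert [:: [:: 0; 0; 1; 0; -1; -1]; [:: 1; -2; 0; 0; 1; 1]];
      LowCert [:: [:: 0; 1; 0; -1; 1; -2]; [:: 0; 1; -1; 2; -1; 0]];
      PosCert [:: [:: 1; 1; 0; -1; 0; 0]; [:: 0; 0; 1; 1; 1; 1];
        [:: 0; 0; 1; 1; -1; -1]];
      SubCert [:: 3%N; 4%N; 1%N; 0%N; 5%N];
      LowCert [:: [:: 0; 1; -1; 0; 0; -1]; [:: 1; 0; 0; 0; 1; -1]];
      LowCert [:: [:: 1; 0; 0; 1; -1; 0]; [:: 1; -1; 1; 0; 0; 0]];
      PosCert [:: [:: 0; 0; 0; 0; 1; 1]; [:: 1; 0; -1; -1; 0; 0];
        [:: 1; 1; 0; 0; -1; 0]];
      LowCert [:: [:: 1; -1; 1; 0; 0; 0]; [:: 1; 0; 1; 0; 1; -2]];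
      SubCert [:: 0%N; 5%N; 4%N; 2%N; 3%N];
      SubCert [:: 0%N; 1%N; 2%N; 3%N; 4%N];
      SubCert [:: 3%N; 2%N; 4%N; 0%N; 5%N];
      SubCert [:: 3%N; 2%N; 1%N; 0%N; 4%N];
      SubCert [:: 0%N; 1%N; 5%N; 3%N; 4%N];
      SubCert [:: 0%N; 5%N; 2%N; 3%N; 4%N];
      LowCert [:: [:: 0; 0; 1; 0; 1; -1]; [:: 1; -1; 0; 0; 0; 1]];
      LowCert [:: [:: 0; 0; 0; 1; 1; -1]; [:: 1; -1; 0; 0; 1; 0]];
      LowCert [:: [:: 0; 0; 0; 1; -1; -1]; [:: 0; 1; -1; 1; 0; 0]];
      LowCert [:: [:: 1; 0; 0; 0; -1; -1]; [:: 1; -1; 1; 0; 0; 0]];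
      LowCert [:: [:: 0; 0; 0; 1; 1; -1]; [:: 0; 1; -1; 0; 0; 1]];
      LowCert [:: [:: 0; 0; 1; 0; -1; -1]; [:: 1; -1; 1; 0; 0; 0]];
      LowCert [:: [:: 0; 0; 1; -1; -1; 0]; [:: 1; -1; 0; 0; 1; 0]];
      PosCert [:: [:: 1; 1; 0; 0; 0; 0]; [:: 0; 0; 1; 1; 0; -1];
        [:: 1; 0; 0; 0; -1; -1]];
      LowCert [:: [:: 1; -1; 1; 0; 0; 0]; [:: 1; 0; -1; 2; -1; 0]];
      PosCert [:: [:: 1; 0; 0; 0; 0; 1]; [:: 0; 1; 0; 0; 1; -1];
        [:: 1; 0; -1; -1; 0; 0]];
      LowCert [:: [:: 0; 0; 1; -1; 1; 0]; [:: 2; -1; 1; 0; -1; 0]];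
      PosCert [:: [:: 0; 0; 0; 1; 0; 1]; [:: 0; 0; 1; 0; 1; -1];
        [:: 1; 1; 0; -1; 0; 0]];
      PosCert [:: [:: 0; 0; 1; 1; 0; 0]; [:: 0; 1; 0; -1; 1; 0];
        [:: 1; 0; 0; 0; -2; 1]];
      PosCert [:: [:: 1; 1; 0; 0; 0; 0]; [:: 1; 0; -1; 0; -1; 0];
        [:: 0; 0; 0; 1; -2; 1]];
      PosCert [:: [:: 1; 1; 0; 0; 0; 0]; [:: 1; 0; 0; -1; -1; 0];
        [:: 0; 0; 1; 0; -2; 1]];
      PosCert [:: [:: 1; 1; 0; 0; 0; 0]; [:: 1; 0; -1; -1; 0; 0];
        [:: 0; 2; 0; 0; -1; -1]];
      PosCert [:: [:: 1; 1; 0; 0; 0; 0]; [:: 1; 0; -1; -1; 0; 0];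
        [:: 0; 0; 0; 2; -1; -1]];
      PosCert [:: [:: 1; 1; 0; 0; 0; 0]; [:: 1; 0; -1; -1; 0; 0];
        [:: 2; 0; 0; 0; -1; -1]];
      PosCert [:: [:: 0; 0; 1; 1; 0; 0]; [:: 1; 0; 0; -1; 1; 0];
        [:: 0; 1; 0; 0; -2; 1]];
      PosCert [:: [:: 1; 1; 0; 0; 0; 0]; [:: 1; 0; -1; -1; 0; 0];
        [:: 0; 0; 2; 0; -1; -1]]]%Z.

(** Open and closed twins of vertices 0 and 1, but only closed twins of the pair 2, 3. *)
Definition paw_patterns : seq bitseq :=
  [:: [:: false; true; false; false];
      [:: false; true; true; true];
      [:: true; false; true; true];
      [:: true; true; false; false];
      [:: true; true; true; true]].

Definition paw_labels : seq (bitseq * nat) :=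
  [:: ([:: false; true; false; false], 0%N);
      ([:: true; false; true; true], 1%N);
      ([:: false; true; false; true], 2%N);
      ([:: false; true; true; false], 2%N);
      ([:: false; true; true; true], 2%N);
      ([:: true; true; false; false], 0%N);
      ([:: true; true; true; true], 1%N)].

Definition paw_certificates : seq certificate :=
  [:: LowCert [:: [:: 1; -1; 0; 1; 0; 0]; [:: 1; 0; 0; 1; 1; -2]];
      SubCert [:: 0%N; 5%N; 3%N; 4%N];
      SubCert [:: 0%N; 4%N; 3%N; 2%N];
      SubCert [:: 0%N; 1%N; 2%N; 4%N];
      SubCert [:: 3%N; 1%N; 0%N; 4%N];
      PosCert [:: [:: 0; 0; 0; 0; 1; 1]; [:: 1; 1; 0; 0; -1; 0];
        [:: 2; 0; -1; -1; 0; 0]];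
      SubCert [:: 4%N; 1%N; 2%N; 5%N];
      SubCert [:: 2%N; 5%N; 0%N; 4%N];
      SubCert [:: 0%N; 5%N; 4%N; 3%N];
      SubCert [:: 4%N; 2%N; 1%N; 5%N];
      SubCert [:: 0%N; 1%N; 3%N; 4%N];
      SubCert [:: 0%N; 4%N; 2%N; 3%N];
      LowCert [:: [:: 0; 1; 0; 0; 1; -1]; [:: 1; -1; 0; 1; 0; 0]];
      LowCert [:: [:: 0; 0; 1; -1; -1; 0]; [:: 1; -1; 1; 0; 0; 0]];
      LowCert [:: [:: 1; 0; 0; 0; -1; -1]; [:: 1; -1; 0; 1; 0; 0]];
      LowCert [:: [:: 0; 1; 0; 0; -1; -1]; [:: 1; 0; 1; 0; 0; -1]];
      LowCert [:: [:: 0; 0; 0; 1; 1; -1]; [:: 1; -1; 0; 0; 0; 1]];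
      LowCert [:: [:: 0; 1; -1; 0; 0; -1]; [:: 1; 0; 0; 0; 1; -1]];
      LowCert [:: [:: 0; 0; 1; -1; 1; 0]; [:: 1; -1; 0; 1; 0; 0]];
      LowCert [:: [:: 0; 0; 0; 1; -1; -1]; [:: 1; -1; 0; 1; 0; 0]];
      LowCert [:: [:: 0; 1; 0; 0; -1; -1]; [:: 1; -2; 1; 0; 0; 0]];
      PosCert [:: [:: 0; 0; 0; 0; 1; 1]; [:: 1; 1; 0; 0; 0; 0];
        [:: 2; 0; -1; -1; 0; 0]];
      PosCert [:: [:: 1; 1; 0; 0; 0; 0]; [:: 0; 2; 0; 0; -1; -1];
        [:: 2; 0; -1; -1; 0; 0]];
      PosCert [:: [:: 1; 1; 0; 0; 0; 0]; [:: 2; 0; 0; 0; -1; -1];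
        [:: 2; 0; -1; -1; 0; 0]];
      PosCert [:: [:: 1; 0; 0; 0; 1; 0]; [:: 0; 1; 0; 0; -2; 1];
        [:: 2; 0; -1; -1; 0; 0]];
      PosCert [:: [:: 0; 1; 0; 0; 1; 0]; [:: 0; 0; 1; 1; -2; 0];
        [:: 1; 0; 0; 0; -2; 1]]]%Z.

(* A graph is loopless, so the matrix [:: [:: true]] is never induced: no
   assumption on forbidden subgraphs is needed around a path on 5 vertices. *)
Lemma P5_check : labelling_check [:: [:: true]] (path_mat 5) 5 P5_labels
  P5_patterns P5_certificates.
Proof. by vm_compute. Qed.

Lemma P4_check : labelling_check (path_mat 5) (path_mat 4) 4 P4_labels
  P4_patterns P4_certificates.
Proof. by vm_compute. Qed.

Lemma paw_check : labelling_check (path_mat 4) paw_mat 3 paw_labels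
  paw_patterns paw_certificates.
Proof. by vm_compute. Qed.

(** * Mixed extensions as labellings *)

(* h x is the index of the part of x, so that G is a mixed extension of a path
   of type t (see iso_mixlab and mixlab_iso). *)
Definition mixlab (G : sgraph) (t : seq int) (h : G -> nat) : Prop :=
  [/\ forall x, (h x < size t)%N,
      forall i, (i < size t)%N -> #|[pred x | h x == i]| = absz t`_i &
      forall x y, x != y ->
        adj x y = if h x == h y then 0 < t`_(h x) else padj (h x) (h y)].

Lemma iso_mixlab (G : sgraph) n (t : n.-tuple int) :
  sg_iso G (mixed_path t) -> exists h : G -> nat, mixlab t h.
Proof.
case=> f bf fadj; exists (fun x => tag (f x) : nat); split.
- by move=> x; rewrite size_tuple ltn_ord.
- rewrite size_tuple => i ltin; pose j := Ordinal ltin; case: bf => f' fK f'K.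
  pose e (k : 'I_(absz (tnth t j))) : G :=
    f' (Tagged (fun i : path_graph n => 'I_(absz (tnth t i))) k).
  have e_inj : injective e.
    by move=> k l /(can_inj f'K)/eqP; rewrite eq_Tagged => /eqP.
  rewrite -(tnth_nth _ t j) -[RHS]card_ord -(card_image e_inj).
  apply: eq_card => x; rewrite inE; apply/eqP/imageP => [|[k _ ->]].
    move=> fx; have /eqP {}fx : tag (f x) == j by rewrite -val_eqE /= fx.
    case fxE : (f x) fx => [l u] /= lj; subst l.
    by exists u; last exact: canRL fK fxE.
  by rewrite /e f'K.
move=> x y xy; rewrite -fadj /= /mixed_adj (inj_eq (bij_inj bf)) xy /=.
by rewrite -(tnth_nth _ t).
Qed.

(** A vertex goes to its part and its position in the enumeration of that part; injectivity and
    counting give the bijection. *)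
Lemma mixlab_iso (G : sgraph) n (t : n.-tuple int) (h : G -> nat) :
  mixlab t h -> sg_iso G (mixed_path t).
Proof.
case; rewrite size_tuple => h_lt h_card h_adj.
pose cls x := enum [pred y | h y == h x].
have idx_lt x : (index x (cls x) < absz (tnth t (Ordinal (h_lt x))))%N.
  rewrite (tnth_nth 0) -h_card // cardE index_mem mem_enum inE //.
pose f x : mixed_path t := Tagged (fun i : path_graph n => 'I_(absz (tnth t i)))
  (Ordinal (idx_lt x)).
have f_inj : injective f.
  move=> x y fxy; have hxy : h x = h y.
    exact: (congr1 (fun z : mixed_path t => tag z : nat) fxy).
  have : index x (cls x) = index y (cls y).
    exact: (congr1 (fun z : mixed_path t => tagged z : nat) fxy).
  rewrite /cls hxy => /(congr1 (nth x (enum [pred z | h z == h y]))).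
  by rewrite !nth_index // mem_enum inE ?hxy.
exists f.
  apply: (inj_card_bij f_inj); rewrite card_tagged sumnE big_map big_enum /=.
  rewrite -sum1_card (partition_big (fun x => Ordinal (h_lt x)) xpredT) //=.
  apply: leq_sum => i _; rewrite card_ord (tnth_nth 0) -h_card // sum1_card.
  exact/eq_leq/eq_card.
move=> x y; rewrite /= /mixed_adj (inj_eq f_inj) /=.
have [->|xy] := eqVneq x y; first by rewrite !eqxx adj_irr.
by rewrite h_adj // -val_eqE /= (tnth_nth 0).
Qed.

(* The quotient matrix of a mixed extension of type t: entry (i, j) is the number
   of neighbours in part j of a vertex of part i. *)
Definition qmx n (t : seq int) : 'M[algC]_n :=
  \matrix_(i, j) if i == j then (if 0 < t`_i then (absz t`_i)%:R - 1 else 0)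
                 else (padj i j)%:R * (absz t`_j)%:R.

(** * Reduction to the quotient matrix *)

Section Quotient.
Variables (G : sgraph) (n : nat) (t : seq int) (h : G -> nat).
Hypotheses (th : mixlab t h) (tn : size t = n).
Hypothesis t0 : forall i, (i < n)%N -> t`_i != 0.

(** [E] is the incidence matrix of vertices and parts. E C E^T puts a loop on every vertex of a
    clique, and [N] removes these loops. *)
Let E : 'M[algC]_(#|G|, n) := \matrix_(x, i) (h (enum_val x) == i)%:R.
Let C : 'M[algC]_n :=
  \matrix_(i, j) (if i == j then 0 < t`_i else padj i j)%:R.
Let T : 'rV[algC]_n := \row_i (absz t`_i)%:R.
Let D : 'rV[algC]_n := \row_i (0 < t`_i)%R%:R.
Let N : 'rV[algC]_#|G| := \row_x (0 < t`_(h (enum_val x)))%R%:R.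

Let h_lt x : (h x < n)%N. Proof. by rewrite -tn; case: th. Qed.

Let mulEl m (X : 'M_(n, m)) x j :
  (E *m X) x j = X (Ordinal (h_lt (enum_val x))) j.
Proof.
rewrite mxE (bigD1 (Ordinal (h_lt (enum_val x)))) //= mxE eqxx mul1r.
rewrite big1 ?addr0 //.
by move=> i; rewrite -val_eqE mxE /= eq_sym => /negPf->; rewrite mul0r.
Qed.

Let mulEr m (X : 'M_(m, n)) x j :
  (X *m E^T) j x = X j (Ordinal (h_lt (enum_val x))).
Proof. by rewrite -[X]trmxK -trmx_mul mxE mulEl !mxE. Qed.

Let adjE : adjmx G = E *m C *m E^T - diag_mx N.
Proof.
apply/matrixP=> x y; rewrite [RHS]mxE mulEr mulEl !mxE -val_eqE /=.
have [<-|xy] := eqVneq x y; first by rewrite eqxx adj_irr subrr.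
case: th => _ _ ->; last by rewrite (inj_eq enum_val_inj).
by rewrite mulr0n subr0.
Qed.

Let EE : E^T *m E = diag_mx T.
Proof.
apply/matrixP=> i j; rewrite !mxE; have [<-|ij] := eqVneq i j.
  have <- : #|[pred x | h x == i]| = absz t`_i.
    by case: th => _ -> //; rewrite tn.
  rewrite mulr1n -[in RHS]sum1_card natr_sum.
  rewrite (reindex (fun x : 'I_#|G| => enum_val x)) /=; last first.
    by apply: onW_bij; exact: enum_val_bij.
  rewrite [RHS]big_mkcond; apply: eq_bigr => x _; rewrite !mxE inE.
  by case: eqP; rewrite ?mulr1 ?mulr0.
rewrite big1 // => x _; rewrite !mxE; case: eqP => [->|]; last by rewrite mul0r.
by rewrite val_eqE (negPf ij) mulr0.
Qed.

Let NE : diag_mx N *m E = E *m diag_mx D.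
Proof.
apply/matrixP=> x i; rewrite mul_diag_mx mul_mx_diag !mxE.
by case: eqP => [->|]; rewrite ?mulr1 ?mul1r ?mulr0 ?mul0r.
Qed.

Let EN : E^T *m diag_mx N = diag_mx D *m E^T.
Proof. by apply: trmx_inj; rewrite !trmx_mul !trmxK !tr_diag_mx NE. Qed.

Let idem m (d : 'rV[algC]_m) : (forall i, exists a : bool, d 0 i = a%:R) ->
  diag_mx d *m diag_mx d = diag_mx d.
Proof.
move=> dP; rewrite mulmx_diag; congr diag_mx; apply/rowP=> i; rewrite mxE.
by have [[] ->] := dP i; rewrite ?mulr1 ?mulr0.
Qed.

Let cancel_mid (V : zmodType) (a z w v : V) :
  a - (z - v) + (w - v) = a - z + w.
Proof. by rewrite opprB addrACA (addrAC v) subrr add0r addrAC. Qed.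

(** Obtained by expanding (X - N)^2 + (X - N) with X = E C E^T: N^2 = N cancels the last N, and
    [EE], [EN], [NE] move all factors between [E] and [E^T]. *)
Let B := C *m diag_mx T *m C - C *m diag_mx D - diag_mx D *m C + C.

Let adj2E : adjmx2 G = E *m B *m E^T.
Proof.
have NN : diag_mx N *m diag_mx N = diag_mx N.
  by apply: idem => x; exists (0 < t`_(h (enum_val x)))%R; rewrite mxE.
rewrite /adjmx2 adjE mulmxBl !mulmxBr NN.
have -> : E *m C *m E^T *m (E *m C *m E^T) = E *m (C *m diag_mx T *m C) *m E^T.
  by rewrite -EE !mulmxA.
have -> : E *m C *m E^T *m diag_mx N = E *m (C *m diag_mx D) *m E^T.
  by rewrite -!mulmxA EN.
have -> : diag_mx N *m (E *m C *m E^T) = E *m (diag_mx D *m C) *m E^T.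
  by rewrite !mulmxA NE.
rewrite /B !(mulmxDr, mulmxDl, mulmxBl, mulmxBr, mulmxN, mulNmx).
exact: cancel_mid.
Qed.

Let qmxE : qmx n t = C *m diag_mx T - diag_mx D.
Proof.
apply/matrixP=> i j; rewrite mxE [in RHS]mxE mul_mx_diag !mxE.
have [->|_] := eqVneq i j; last by rewrite mulr0n subr0.
by rewrite mulr1n; case: ifP => _; rewrite ?mul1r ?mul0r ?subrr.
Qed.

Let BT : B *m diag_mx T = qmx n t *m (qmx n t + 1%:M).
Proof.
have DD : diag_mx D *m diag_mx D = diag_mx D.
  by apply: idem => i; exists (0 < t`_i)%R; rewrite mxE.
rewrite qmxE /B mulmxDr mulmx1 !mulmxBr !mulmxBl DD !mulmxDl !mulNmx.
rewrite -!mulmxA (diag_mxC D T) !mulmxA.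
by rewrite cancel_mid (addrAC (_ *m _)).
Qed.

(** E B E^T has rank at most that of B; conversely, multiplying it by E^T and E gives T B T with T
    invertible, as the parts are nonempty. *)
Lemma rank_adjmx2_mixlab :
  \rank (adjmx2 G) = \rank (qmx n t *m (qmx n t + 1%:M)).
Proof.
have uT : diag_mx T \in unitmx.
  rewrite unitmxE det_diag unitfE prodf_seq_neq0; apply/allP=> i _ /=.
  by rewrite mxE pnatr_eq0 absz_eq0 t0.
rewrite -BT mxrankMfree ?row_free_unit //.
apply/eqP; rewrite eqn_leq; apply/andP; split.
  by rewrite adj2E -mulmxA (leq_trans (mxrankM_maxr _ _)) ?mxrankM_maxl.
have eqB : E^T *m adjmx2 G *m E = diag_mx T *m B *m diag_mx T.
  by rewrite adj2E -EE !mulmxA.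
have <- : \rank (E^T *m adjmx2 G *m E) = \rank B.
  by rewrite eqB mxrankMfree ?row_free_unit // (eqmxMfull _ _) ?row_full_unit.
by rewrite (leq_trans (mxrankM_maxl _ _)) ?mxrankM_maxr.
Qed.

End Quotient.

(** * Lower bounds on the eigenvalue counts of mixed extensions *)

Lemma mixlab_class (G : sgraph) t (h : G -> nat) i :
  mixlab t h -> (i < size t)%N -> t`_i != 0 -> exists x, h x = i.
Proof.
move=> [_ card _] lti; rewrite -absz_eq0 -card // -lt0n.
by move=> /card_gt0P[x /eqP]; exists x.
Qed.

(** Induction along the path; part 0 may be a coclique, so its vertices are joined through part
    1. *)
Lemma mixlab_connected (G : sgraph) t (h : G -> nat) :
  mixlab t h -> (1 < size t)%N -> (forall i, (i < size t)%N -> t`_i != 0) ->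
  sg_connected G.
Proof.
move=> th lt1 t0; have [h_lt _ h_adj] := th.
have cls i : (i < size t)%N -> exists x, h x = i.
  by move=> lti; apply: mixlab_class th lti (t0 i lti).
have csym : connect_sym (@adj G) by apply: sym_connect_sym; apply: adj_sym.
have adjS x y : h y = (h x).+1 -> adj x y.
  move=> hy; rewrite h_adj ?hy ?ltn_eqF //; first by rewrite /padj eqxx.
  by apply: contra_eq_neq hy => ->; rewrite ltn_eqF.
have [x0 hx0] := cls 0%N (ltnW lt1); have [x1 hx1] := cls 1%N lt1.
suff conn0 n x : h x = n -> connect (@adj G) x0 x.
  move=> x y; apply: (@connect_trans _ _ x0); last exact: conn0 erefl.
  by rewrite csym; exact: conn0 erefl.
elim: n x => [|n IHn] x hx.
  apply: (@connect_trans _ _ x1); first by rewrite connect1 // adjS // hx1 hx0.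
  by rewrite csym connect1 // adjS // hx1 hx.
have [|y hy] := cls n; first by rewrite ltnW // -hx.
by rewrite (connect_trans (IHn y hy)) // connect1 // adjS ?hy.
Qed.

Lemma mixlab_relmat (G : sgraph) t (h : G -> nat) (s : seq G) :
  mixlab t h -> uniq (map h s) ->
  relmat (@adj G) s = relmat padj (map h s).
Proof.
move=> [_ _ h_adj] us; rewrite /relmat -map_comp.
apply/eq_in_map => x xs /=; rewrite -map_comp; apply/eq_in_map => y ys /=.
have [<-|xy] := eqVneq x y; first by rewrite adj_irr /padj gtn_eqF.
rewrite h_adj // ifN //; apply: contra xy => /eqP hxy.
have := nth_uniq (h x) _ _ us; rewrite size_map.
move=> /(_ (index x s) (index y s)); rewrite !index_mem => /(_ xs ys).
rewrite !(nth_map x) ?index_mem // !nth_index // hxy eqxx => /esym/eqP ixy.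
by rewrite -(nth_index x xs) ixy nth_index.
Qed.

Lemma mixlab_Gstar (G : sgraph) t (h : G -> nat) :
  mixlab t h -> (2 < size t)%N -> (forall i, (i < size t)%N -> t`_i != 0) ->
  (\rank (adjmx2 G) <= 3)%N ->
  (2 <= count (fun x => (0 < x)%R) (eigenvalues (adjmx G)))%N -> in_Gstar G.
Proof.
move=> th lt2 t0 rk pos2; apply: Gstar_intro => //.
  by apply: mixlab_connected th _ t0; apply: ltnW.
have cls i : (i < 3)%N -> exists x, h x = i.
  by move=> lti; apply: mixlab_class th _ (t0 i _); apply: leq_trans lt2.
have [x0 h0] := cls 0%N isT; have [x1 h1] := cls 1%N isT.
have [x2 h2] := cls 2%N isT.
have hs : map h [:: x0; x1; x2] = iota 0 3 by rewrite /= h0 h1 h2.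
have us : uniq (map h [:: x0; x1; x2]) by rewrite hs.
(* An integer approximation of the eigenvector (1, -sqrt 2, 1) of P_3 for -sqrt 2; the form A + I
   takes the value -7. *)
apply: (@orth_family_low G [:: x0; x1; x2] [:: [:: 2; -3; 2]%Z]).
rewrite -addI_amat; last exact: map_uniq us.
by rewrite (mixlab_relmat th us) hs.
Qed.

Lemma mixlab_pos4 (G : sgraph) t (h : G -> nat) :
  mixlab t h -> (3 < size t)%N -> (forall i, (i < size t)%N -> t`_i != 0) ->
  (2 <= count (fun x => (0 < x)%R) (eigenvalues (adjmx G)))%N.
Proof.
move=> th lt3 t0.
have cls i : (i < 4)%N -> exists x, h x = i.
  by move=> lti; apply: mixlab_class th _ (t0 i _); apply: leq_trans lt3.
have [[x0 h0] [x1 h1]] := conj (cls 0%N isT) (cls 1%N isT).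
have [[x2 h2] [x3 h3]] := conj (cls 2%N isT) (cls 3%N isT).
have hs : map h [:: x0; x1; x2; x3] = iota 0 4 by rewrite /= h0 h1 h2 h3.
(* The two end edges of P_4, the second made A-orthogonal to the first by Gram-Schmidt. *)
apply: (@orth_family_pos G [:: x0; x1; x2; x3]
  [:: [:: 1; 1; 0; 0]; [:: -1; -1; 2; 2]]%Z).
by rewrite (mixlab_relmat th) hs.
Qed.

Lemma mixlab_pos3 (G : sgraph) t (h : G -> nat) :
  mixlab t h -> size t = 3%N -> (forall i, (i < size t)%N -> t`_i != 0) ->
  1 < t`_2 -> (2 <= count (fun x => (0 < x)%R) (eigenvalues (adjmx G)))%N.
Proof.
move=> th st t0 lt1; have [_ h_card h_adj] := th.
have cls i : (i < 2)%N -> exists x, h x = i.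
  by move=> lti; apply: mixlab_class th _ (t0 i _); rewrite st ltnW.
have [[x0 h0] [x1 h1]] := conj (cls 0%N isT) (cls 1%N isT).
have : (1 < #|[pred x | h x == 2]|)%N by rewrite h_card ?st //; lia.
move=> /card_gt1P[x2 [x3]]; rewrite !inE => -[/eqP h2 /eqP h3 ne].
have eM : relmat (@adj G) [:: x0; x1; x2; x3] = paw_mat.
  have t2 : 0 < t`_2 by apply: lt_trans lt1.
  have neq x y : h x != h y -> x != y by apply: contraNneq => ->.
  rewrite /relmat /= !adj_irr !(adj_sym x3) !(adj_sym x2) !(adj_sym x1 x0).
  by rewrite !h_adj ?h0 ?h1 ?h2 ?h3 ?t2 // 1?eq_sym // ?neq ?h0 ?h1 ?h2 ?h3.
apply: (@orth_family_pos G [:: x0; x1; x2; x3]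
  [:: [:: 0; 0; 1; 1]; [:: 2; 1; -1; -1]]%Z).
by rewrite eM.
Qed.

(** * Singular quotients *)

(** A continuant: one term per matching of P_4, each edge contributing a sign and the two entries
    [n] at its ends. *)
Lemma det_tridiagonal4 (R : comNzRingType) (d n : nat -> R) :
  \det (\matrix_(i < 4, j < 4)
    if i == j then d i else (padj i j)%:R * n j) =
  d 0%N * d 1%N * d 2%N * d 3%N + n 0%N * n 1%N * n 2%N * n 3%N
  - n 0%N * n 1%N * d 2%N * d 3%N - n 1%N * n 2%N * d 0%N * d 3%N
  - n 2%N * n 3%N * d 0%N * d 1%N.
Proof.
rewrite (expand_det_row _ ord0) !big_ord_recl big_ord0 !mxE /= !mul0r !addr0.
rewrite /cofactor.
do 2! rewrite ?(expand_det_row _ ord0) ?big_ord_recl ?big_ord0 /cofactor.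
by rewrite !det_mx11 !mxE /= /padj /bump /=; ring.
Qed.

(* The diagonals of qmx 4 t and of qmx 4 t + 1. *)
Definition diag0 (t : seq int) i : nat :=
  if 0 < t`_i then (absz t`_i).-1 else 0%N.

Definition diag1 (t : seq int) i : nat := if 0 < t`_i then absz t`_i else 1%N.

(* det_tridiagonal4 with the negative terms moved to the right-hand side. *)
Definition singular4 (n d : nat -> nat) : bool :=
  (d 0 * d 1 * d 2 * d 3 + n 0 * n 1 * n 2 * n 3 ==
   n 0 * n 1 * d 2 * d 3 + n 1 * n 2 * d 0 * d 3 + n 2 * n 3 * d 0 * d 1)%N.

Lemma rank_qmx4 t : (forall i, (i < 4)%N -> t`_i != 0) ->
  (\rank (qmx 4 t *m (qmx 4 t + 1%:M)) <= 3)%N =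
  singular4 (fun i => absz t`_i) (diag0 t) ||
  singular4 (fun i => absz t`_i) (diag1 t).
Proof.
move=> t0; set Q := qmx 4 t.
have -> : (\rank (Q *m (Q + 1%:M)) <= 3)%N =
    (\det Q == 0) || (\det (Q + 1%:M) == 0).
  rewrite -mulf_eq0 -det_mulmx -[RHS]negbK -unitfE -unitmxE -row_free_unit.
  by rewrite /row_free neq_ltn (ltnNge 4) rank_leq_row orbF.
have det_eq0 (d : nat -> nat) : (\det (\matrix_(i < 4, j < 4)
      if i == j then (d i)%:R else (padj i j)%:R * (absz t`_j)%:R) == 0 :> algC)
    = singular4 (fun i => absz t`_i) d.
  rewrite (det_tridiagonal4 (fun i => (d i)%:R) (fun i => (absz t`_i)%:R)).
  rewrite -!addrA -!opprD !addrA subr_eq0.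
  by rewrite -!(natrM, natrD) eqr_nat.
congr (_ || _); rewrite -det_eq0; congr (\det _ == 0).
  apply/matrixP=> i j; rewrite !mxE /diag0; case: eqP => // _.
  by case: ifP => // _; rewrite -subn1 natrB // lt0n absz_eq0 t0.
apply/matrixP=> i j; rewrite !mxE /diag1.
case: eqP => [_|_]; last by rewrite addr0.
by case: ifP => _; rewrite ?subrK ?add0r.
Qed.

(** For all p, q, r, [u] is a left null vector of Q and [v] one of Q + 1. These matrices commute, so
    both vectors kill the product; being independent, they leave rank at most 3. *)
Lemma rank_qmx5 (p q r : nat) : (0 < p)%N -> (0 < q)%N -> (0 < r)%N ->
  (\rank (qmx 5 [:: 1%R; p%:Z; - q%:Z; r%:Z; 1%R] *m
    (qmx 5 [:: 1%R; p%:Z; - q%:Z; r%:Z; 1%R] + 1%:M)) <= 3)%N.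
Proof.
move=> p0 q0 r0; set Q := qmx 5 _.
have t1 : 0 < p%:Z by []. have t3 : 0 < r%:Z by [].
have t2 : 0 < - q%:Z = false by rewrite oppr_gt0.
pose u : 'rV[algC]_5 := \row_i [:: 1; 0; -1; 0; 1]`_i.
pose v : 'rV[algC]_5 := \row_i [:: -1; 1; 0; -1; 1]`_i.
have uQ : u *m Q = 0.
  apply/rowP => j; rewrite !mxE !big_ord_recl big_ord0 !mxE /=.
  case: j => -[|[|[|[|[|//]]]]] ltj; rewrite -!val_eqE /= /padj /= /bump /=;
    rewrite ?t1 ?t2 ?t3 ?abszN /=; ring.
have vQ : v *m (Q + 1%:M) = 0.
  apply/rowP => j; rewrite !mxE !big_ord_recl big_ord0 !mxE /=.
  case: j => -[|[|[|[|[|//]]]]] ltj; rewrite -!val_eqE /= /padj /= /bump /=;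
    rewrite ?t1 ?t2 ?t3 ?abszN /=; ring.
pose K : 'M[algC]_(1 + 1, 5) := col_mx u v.
have KQ : K *m (Q *m (Q + 1%:M)) = 0.
  rewrite mul_col_mx mulmxA uQ mul0mx.
  have -> : Q *m (Q + 1%:M) = (Q + 1%:M) *m Q.
    by rewrite mulmxDr mulmxDl mulmx1 mul1mx.
  by rewrite mulmxA vQ mul0mx col_mx0.
have rK : \rank K = 2%N.
  have : row_free K.
    (* Columns 2 and 1 of [K] are (-1, 0) and (0, 1). *)
    apply/row_freeP; exists (row_mx (- delta_mx 2 0) (delta_mx 1 0)).
    rewrite mul_col_row scalar_mx_block !mulmxN -!colE.
    by congr block_mx; apply/matrixP=> i j; rewrite !ord1 !mxE /= ?opprK ?oppr0.
  by move/eqP.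
by have := mulmx0_rank_max KQ; rewrite rK.
Qed.

(** * Unit fractions *)

(** This is 1/x + 1/y + 1/z = 1. A denominator u of at least 7 would leave 1/v + 1/w in [6/7, 1),
    which no v, w attain together with the equation; the rest is enumeration. *)
Lemma egyptian3 x y z : (x * y + y * z + z * x = x * y * z)%N ->
  (0 < x)%N -> (0 < y)%N -> (0 < z)%N ->
  (x, y, z) \in [:: (3, 3, 3); (2, 4, 4); (4, 2, 4); (4, 4, 2); (2, 3, 6);
    (2, 6, 3); (3, 2, 6); (3, 6, 2); (6, 2, 3); (6, 3, 2)]%N.
Proof.
have bound u v w : (u * v + v * w + w * u = u * v * w)%N ->
    (0 < u)%N -> (0 < v)%N -> (0 < w)%N -> (u < 7)%N.
  move=> eqn u0 v0 w0; rewrite ltnNge; apply/negP => u7.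
  have [v2|v3] := leqP v 2.
    have {v2} [ev|ev] : v = 1%N \/ v = 2%N by lia.
      by subst v; nia.
    subst v; have {}eqn : (2 * u + 2 * w = u * w)%N by nia.
    have [w2|w3] := leqP w 2; last by nia.
    have : (u * w <= u * 2)%N by rewrite leq_mul2l w2 orbT.
    by lia.
  have [w2|w3] := leqP w 2; last by nia.
  have {w2} [ew|ew] : w = 1%N \/ w = 2%N by lia.
    by subst w; nia.
  by subst w; nia.
move=> eqn x0 y0 z0.
have x7 := bound _ _ _ eqn x0 y0 z0.
have y7 : (y < 7)%N by apply: (bound y z x) => //; lia.
have z7 : (z < 7)%N by apply: (bound z x y) => //; lia.
have /allP chk : all (fun x => all (fun y => all (fun z =>
    (x * y + y * z + z * x == x * y * z)%N ==>
    ((x, y, z) \in [:: (3, 3, 3); (2, 4, 4); (4, 2, 4); (4, 4, 2); (2, 3, 6);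
    (2, 6, 3); (3, 2, 6); (3, 6, 2); (6, 2, 3); (6, 3, 2)]%N))
    (iota 1 6)) (iota 1 6)) (iota 1 6) by vm_compute.
have mem7 u : (0 < u)%N -> (u < 7)%N -> u \in iota 1 6.
  by rewrite mem_iota => -> ->.
have /allP/(_ y (mem7 y y0 y7)) := chk x (mem7 x x0 x7).
move=> /allP/(_ z (mem7 z z0 z7)).
by rewrite eqn eqxx.
Qed.

(* That is, (m0 m1 - 1) (m2 m3 - 1) = m1 m2. *)
Lemma unit_products m0 m1 m2 m3 :
  (1 + m0 * m1 * m2 * m3 = m0 * m1 + m1 * m2 + m2 * m3)%N ->
  (0 < m0)%N -> (0 < m1)%N -> (0 < m2)%N -> (0 < m3)%N ->
  (m0, m1, m2, m3) \in [:: (1, 3, 2, 2); (2, 1, 1, 2); (1, 2, 1, 3);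
    (2, 2, 3, 1); (3, 1, 2, 1)]%N.
Proof.
have half a b c : (1 + b * c * a = b + b * c + c * a)%N ->
  (0 < a)%N -> (0 < b)%N -> (0 < c)%N ->
  (b, c, a) = (3, 2, 2)%N \/ (b, c, a) = (2, 1, 3)%N.
  move=> eqn a0 b0 c0.
  have [a1|a2] := leqP a 1.
    by exfalso; (have ea : a = 1%N by lia); subst a; nia.
  have [a2'|a3] := leqP a 2.
    have ea : a = 2%N by lia.
    subst a; left.
    have [b2|b3] := leqP b 2.
      exfalso; have [eb|eb] : b = 1%N \/ b = 2%N by lia.
        by subst b; nia.
      by subst b; nia.
    have [c1|c2] := leqP c 1.
      by exfalso; (have ec : c = 1%N by lia); subst c; nia.
    have eb : b = 3%N by nia.
    by subst b; congr (_, _, _); lia.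
  right.
  have [b1|b2] := leqP b 1.
    by exfalso; (have eb : b = 1%N by lia); subst b; nia.
  have c1 : c = 1%N by nia.
  subst c; have b2' : b = 2%N by nia.
  by subst b; congr (_, _, _); lia.
move=> eqn a0 b0 c0 d0.
have [a1|a2] := leqP m0 1.
  have ea : m0 = 1%N by lia.
  subst m0; rewrite !mul1n in eqn.
  by have [[-> -> ->]|[-> -> ->]] := half _ _ _ eqn d0 b0 c0.
have [d1|d2] := leqP m3 1.
  have ed : m3 = 1%N by lia.
  subst m3; have eqn' : (1 + m2 * m1 * m0 = m2 + m2 * m1 + m1 * m0)%N by lia.
  by have [[-> -> ->]|[-> -> ->]] := half _ _ _ eqn' a0 c0 b0.
(* With both ends at least 2, (2 m1 - 1) (2 m2 - 1) <= m1 m2, which forces m1 = m2 = 1. *)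
have le_mm : ((2 * m1 - 1) * (2 * m2 - 1) <= (m0 * m1 - 1) * (m2 * m3 - 1))%N.
  apply: leq_mul; apply: leq_sub2r; rewrite 1?[(m2 * _)%N]mulnC leq_mul2r;
    by rewrite ?a2 ?d2 orbT.
have pred_mul x y z : (0 < x -> 0 < y -> 1 + x * y = x + z + y ->
    (x - 1) * (y - 1) = z)%N.
  by case: x => // x; case: y => // y _ _; rewrite !subn1 /=; nia.
rewrite (_ : (m0 * m1 - 1) * (m2 * m3 - 1) = m1 * m2)%N in le_mm; last first.
  by apply: pred_mul; rewrite ?muln_gt0 ?a0 ?b0 ?c0 ?d0 // mulnA.
have [eb ec] : m1 = 1%N /\ m2 = 1%N.
  move: le_mm b0 c0; clear; case: m1 => // u; case: m2 => // v; nia.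
subst m1 m2; move: eqn a2 d2; clear; case: m0 => [|[|u]] //.
case: m3 => [|[|v]] // eqn _ _.
have [-> ->] : u = 0%N /\ v = 0%N by nia.
by [].
Qed.

Definition clique_types : seq (nat * nat * nat * nat) :=
  [:: (2, 2, 2, 7); (2, 2, 3, 4); (2, 2, 6, 3); (2, 3, 2, 5);
      (2, 3, 4, 3); (2, 5, 2, 4); (2, 5, 3, 3); (3, 2, 2, 3)]%N.

(* That is, (1/a + 1/q) (1/b + 1/r) = 1. *)
Lemma clique_typesP a b q r :
  (0 < a)%N -> (0 < b)%N -> (1 < q)%N -> (1 < r)%N ->
  ((a + q) * (b + r) = a * b * q * r)%N ->
  (a.+1, q, r, b.+1) \in clique_types \/ (b.+1, r, q, a.+1) \in clique_types.
Proof.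
have half b' q' r' : (0 < b')%N -> (1 < q')%N -> (1 < r')%N ->
  ((1 + q') * (b' + r') = b' * q' * r')%N ->
  (q', r', b'.+1) \in [:: (2, 2, 7); (2, 3, 4); (2, 6, 3); (3, 2, 5);
           (3, 4, 3); (5, 2, 4); (5, 3, 3)]%N.
  move=> b0 q1 r1 eqn.
  (* For a = 1 the equation reads 1/b + 1/r + 1/(q + 1) = 1. *)
  have eg : (b' * r' + r' * q'.+1 + q'.+1 * b' = b' * r' * q'.+1)%N by nia.
  move: (egyptian3 eg b0 (ltnW r1) isT) q1; rewrite !inE.
  by do 9! [case/orP => [/eqP[-> -> ->] //|]] => /eqP[-> -> ->].
move=> a0 b0 q1 r1 eqn.
have [a1|a2] := leqP a 1.
  have ea : a = 1%N by lia.
  subst a; rewrite mul1n in eqn; left.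
  have := half _ _ _ b0 q1 r1 eqn; rewrite !inE.
  by do 6! [case/orP => [/eqP[-> -> ->] //|]] => /eqP[-> -> ->].
have [b1|b2] := leqP b 1.
  have eb : b = 1%N by lia.
  subst b; right; have eqn' : ((1 + r) * (a + q) = a * r * q)%N by lia.
  have := half _ _ _ a0 r1 q1 eqn'; rewrite !inE.
  by do 6! [case/orP => [/eqP[-> -> ->] //|]] => /eqP[-> -> ->].
(* Now both factors 1/a + 1/q and 1/b + 1/r are at most 1, so both equal 1 and all four numbers are
   2. *)
have h1 : (a + q <= a * q)%N by nia.
have h2 : (b + r <= b * r)%N by nia.
have tight s u v w :
    (s <= u -> v <= w -> s * v = u * w -> 0 < u -> 0 < v -> s = u)%N.
  by move=> su vw svuw u0 v0; nia.
have two u v : (1 < u -> 1 < v -> u + v = u * v -> u = 2 /\ v = 2)%N.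
  by move=> u1 v1 uv; nia.
have eqn' : ((a + q) * (b + r) = (a * q) * (b * r))%N by rewrite eqn; lia.
have [-> ->] : a = 2%N /\ q = 2%N.
  by apply: two => //; apply: (tight _ _ _ _ h1 h2) => //; lia.
have [-> ->] : b = 2%N /\ r = 2%N.
  apply: two => //; apply: (tight _ _ _ _ h2 h1); last by lia.
  - by rewrite mulnC eqn' mulnC.
  - by lia.
by left.
Qed.

(** The solutions of 1/x + 1/y + 1/z = 1 with x increased by one. *)
Definition unit_triples : seq (nat * nat * nat) :=
  [:: (3, 3, 6); (3, 4, 4); (3, 6, 3); (4, 2, 6); (4, 3, 3);
      (4, 6, 2); (5, 2, 4); (5, 4, 2); (7, 2, 3); (7, 3, 2)]%N.

(** If d0 = 0, the equation becomes n0 n1 n2 n3 = n0 n1 d2 d3, impossible since each d is below its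
    n; likewise for d3 = 0, or d1 = d2 = 0. A single vanishing middle entry gives three unit
    fractions, none gives the product equation of [clique_typesP]. *)
Lemma singular_diag0 (n d : nat -> nat) : singular4 n d ->
  (forall i, (i < 4)%N -> (0 < n i)%N /\ (d i = 0%N \/ n i = (d i).+1)) ->
  [/\ (0 < d 0)%N, (0 < d 3)%N &
   [\/ [/\ (0 < d 1)%N, d 2 = 0%N & (n 0, n 1, n 3)%N \in unit_triples],
       [/\ (0 < d 2)%N, d 1 = 0%N & (n 3, n 2, n 0)%N \in unit_triples] |
       [/\ (0 < d 1)%N, (0 < d 2)%N &
           (n 0, n 1, n 2, n 3)%N \in clique_types \/
           (n 3, n 2, n 1, n 0)%N \in clique_types]]]%N.
Proof.
move=> /eqP eqn nd.
have [[n0 e0] [n1 e1]] := conj (nd 0%N isT) (nd 1%N isT).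
have [[n2 e2] [n3 e3]] := conj (nd 2%N isT) (nd 3%N isT).
move: (n 0%N) (n 1%N) (n 2%N) (n 3%N) (d 0%N) (d 1%N) (d 2%N) (d 3%N)
  n0 n1 n2 n3 e0 e1 e2 e3 eqn => {n d nd} n0 n1 n2 n3 d0 d1 d2 d3.
move=> n0P n1P n2P n3P e0 e1 e2 e3 eqn.
have lt_mul m n c d : (0 < m -> 0 < n -> (c = 0 \/ m = c.+1) ->
    (d = 0 \/ n = d.+1) -> c * d < m * n)%N.
  by move=> m0 k0 em ek; apply: ltn_mul; lia.
have d0P : (0 < d0)%N.
  rewrite lt0n; apply/eqP => d00; subst d0.
  have lt23 := lt_mul _ _ _ _ n2P n3P e2 e3.
  have : (n0 * n1 * (n2 * n3) = n0 * n1 * (d2 * d3))%N by lia.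
  by move/eqP; rewrite eqn_pmul2l ?muln_gt0 ?n0P ?n1P // gtn_eqF.
have d3P : (0 < d3)%N.
  rewrite lt0n; apply/eqP => d30; subst d3.
  have lt01 := lt_mul _ _ _ _ n0P n1P e0 e1.
  have : (n2 * n3 * (n0 * n1) = n2 * n3 * (d0 * d1))%N by lia.
  by move/eqP; rewrite eqn_pmul2l ?muln_gt0 ?n2P ?n3P // gtn_eqF.
have {}e0 : n0 = d0.+1 by lia.
have {}e3 : n3 = d3.+1 by lia.
have one_sided a q s : (0 < a -> 0 < s -> 0 < q ->
    a.+1 * q.+1 * s.+1 = q.+1 * a * s + s.+1 * a * q ->
    (a.+1, q.+1, s.+1) \in unit_triples)%N.
  move=> a0 s0 q0 eqq.
  have eg : (a * q.+1 + q.+1 * s.+1 + s.+1 * a = a * q.+1 * s.+1)%N by lia.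
  move: (egyptian3 eg a0 isT isT); rewrite !inE.
  by do 9! [case/orP => [/eqP[-> -> ->] //|]] => /eqP[-> -> ->].
split=> //; subst n0 n3.
have [d10|d1P] := posnP d1; have [d20|d2P] := posnP d2.
- subst d1 d2; exfalso.
  have /eqP : (n1 * n2 * (d0.+1 * d3.+1) = n1 * n2 * (d0 * d3))%N by lia.
  by rewrite eqn_pmul2l ?muln_gt0 ?n1P ?n2P // gtn_eqF // lt_mul //; right.
- constructor 2; split=> //; subst d1.
  have {}e2 : n2 = d2.+1 by lia.
  subst n2; apply: one_sided => //.
  by apply/eqP; rewrite -(eqn_pmul2l n1P); apply/eqP; lia.
- constructor 1; split=> //; subst d2.
  have {}e1 : n1 = d1.+1 by lia.
  subst n1; apply: one_sided => //.
  by apply/eqP; rewrite -(eqn_pmul2l n2P); apply/eqP; lia.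
constructor 3; split=> //.
have {}e1 : n1 = d1.+1 by lia.
have {}e2 : n2 = d2.+1 by lia.
subst n1 n2; apply: clique_typesP => //; nia.
Qed.

(** Dividing by all d leaves an equation in the m alone. A clique has m = 1 whatever its size, which
    is the source of the free parameters in (ii). *)
Lemma singular_diag1 (n d m : nat -> nat) : singular4 n d ->
  (forall i, (i < 4)%N ->
    [/\ (0 < d i)%N, (0 < m i)%N & n i = (d i * m i)%N]) ->
  (m 0, m 1, m 2, m 3)%N \in [:: (1, 3, 2, 2); (2, 1, 1, 2); (1, 2, 1, 3);
    (2, 2, 3, 1); (3, 1, 2, 1)]%N.
Proof.
move=> /eqP eqn nd.
have [[d0 m0 e0] [d1 m1 e1]] := conj (nd 0%N isT) (nd 1%N isT).
have [[d2 m2 e2] [d3 m3 e3]] := conj (nd 2%N isT) (nd 3%N isT).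
apply: unit_products => //; apply/eqP.
rewrite -(@eqn_pmul2l (d 0 * d 1 * d 2 * d 3)%N) ?muln_gt0 ?d0 ?d1 ?d2 ?d3 //.
by apply/eqP; rewrite e0 e1 e2 e3 in eqn; lia.
Qed.

(** * Graphs of G* as mixed extensions of paths *)

(** Counterpart of [pos_family]: the eigenvectors attain the count. *)
Lemma pos_eigenspace (G : sgraph) :
  let k := count (fun x => (0 < x)%R) (eigenvalues (adjmx G)) in
  exists (U : 'M[algC]_(k, #|G|)) (g : 'rV[algC]_k),
    U *m adjmx G *m U ^t* = diag_mx g /\ forall i, 0 < g 0 i.
Proof.
rewrite count_eigenvalues ?adjmx_herm //.
set P := spectralmx (adjmx G); set d := spectral_diag (adjmx G).
set S := [pred i | _]; move=> k.
have uP : P \is unitarymx by exact: spectral_unitarymx.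
have PA : P *m adjmx G *m P ^t* = diag_mx d.
  have PP := unitarymxP uP.
  have /orthomx_spectralP eqA := hermitian_normalmx (adjmx_herm G).
  by rewrite eqA invmx_unitary // -/P -/d !mulmxA PP mul1mx -mulmxA PP mulmx1.
exists (rowsub (fun i : 'I_k => enum_val i) P), (\row_i d 0 (enum_val i)).
split=> [|i]; last by rewrite mxE; have := enum_valP i.
apply/matrixP=> i j.
transitivity ((P *m adjmx G *m P ^t* ) (enum_val i) (enum_val j)).
  rewrite !mxE; apply: eq_bigr => l _; rewrite !mxE; congr (_ * _).
  by apply: eq_bigr => l' _; rewrite !mxE.
by rewrite PA !mxE (inj_eq enum_val_inj).
Qed.

(* If non-adjacency is transitive, A = J - F F^T for the 0/1 matrix F sending
   each vertex to its class, so A is nonpositive on the hyperplane 1^perp. *)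
Lemma multipartite_pos (G : sgraph) :
  (forall x y w : G, adj x y -> adj w x || adj w y) ->
  (count (fun x => (0 < x)%R) (eigenvalues (adjmx G)) <= 1)%N.
Proof.
move=> trG; have := pos_eigenspace G; cbv zeta.
move: (count _ _) => k [U [g [eqU g0]]]; rewrite leqNgt; apply/negP => k2.
pose J : 'cV[algC]_#|G| := const_mx 1.
have [c c0 cJ] : exists2 c : 'rV_k, c != 0 & c *m (U *m J) = 0.
  have /rowV0Pn[c /sub_kermxP cU c0] : kermx (U *m J) != 0.
    rewrite kermx_eq0 -row_leq_rank -ltnNge.
    exact: leq_ltn_trans (rank_leq_col _) k2.
  by exists c.
(* The multipartite class of [x], shared exactly by the vertices not adjacent to it. *)
pose r (x : G) := [set z | ~~ adj x z].
have rE x y : (r x == r y) = ~~ adj x y.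
  apply/eqP/idP => [rxy|nxy].
    have : y \in r y by rewrite inE adj_irr.
    by rewrite -rxy inE.
  apply/setP => z; rewrite !inE; congr (~~ _); apply/idP/idP => xz.
    by have := trG _ _ y xz; rewrite (adj_sym y x) (negPf nxy).
  by have := trG _ _ x xz; rewrite (negPf nxy).
pose F : 'M[algC]_(#|G|, #|{set G}|) :=
  \matrix_(x, S) (r (enum_val x) == enum_val S)%:R.
have FF : F *m F ^t* = J *m J^T - adjmx G.
  apply/matrixP=> x y; rewrite !mxE big_ord1 !mxE mulr1.
  rewrite (bigD1 (enum_rank (r (enum_val x)))) //= !mxE enum_rankK eqxx mul1r.
  rewrite big1 => [|S nS]; last first.
    rewrite !mxE [_ == _](_ : _ = false) ?mul0r //.
    by apply: contraNF nS => /eqP->; rewrite enum_valK.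
  rewrite addr0 eq_sym rE adj_sym conjC_nat.
  by case: (adj _ _); rewrite ?subr0 ?subrr.
have ler0 : (c *m U *m adjmx G *m (c *m U) ^t* ) 0 0 <= 0.
  have -> : adjmx G = J *m J^T - F *m F ^t* by rewrite FF opprB addrC subrK.
  rewrite mulmxBr mulmxBl !mulmxA -(mulmxA c) cJ !mul0mx sub0r mxE oppr_le0.
  rewrite -mulmxA -map_mxM -trmx_mul mxE sumr_ge0 // => i _.
  by rewrite !mxE mul_conjC_ge0.
have : 0 < (c *m U *m adjmx G *m (c *m U) ^t* ) 0 0.
  rewrite trmx_mul map_mxM !mulmxA -(mulmxA c) -(mulmxA c) eqU mxE.
  have /rV0Pn[i ci] := c0.
  have term j : (c *m diag_mx g) 0 j * (c ^t* ) j 0 = g 0 j * `|c 0 j| ^+ 2.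
    by rewrite mul_mx_diag !mxE normCK mulrAC mulrC mulrA.
  under eq_bigr do rewrite term.
  rewrite (bigD1 i) //= ltr_pwDl ?mulr_gt0 ?exprn_gt0 ?normr_gt0 //.
  by apply: sumr_ge0 => j _; rewrite mulr_ge0 ?exprn_ge0 // ltW.
by move=> /lt_le_trans/(_ ler0); rewrite ltxx.
Qed.

(** The neighbours of x or y form a set closed under adjacency: a vertex v outside it, adjacent to
    some u inside, would form with u, x, y a paw or a P_4, according as u sees both or one of x,
    y. *)
Lemma paw_path_free (G : sgraph) : sg_connected G ->
  (forall s : seq G, uniq s -> relmat (@adj G) s <> path_mat 4) ->
  (forall s : seq G, uniq s -> relmat (@adj G) s <> paw_mat) ->
  forall x y w : G, adj x y -> adj w x || adj w y.
Proof.
move=> cG noP noK x y w xy; pose X := [pred w | adj w x || adj w y].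
suff cX : closed (@adj G) X.
  have : x \in X by rewrite inE xy orbT.
  by rewrite (closed_connect cX (cG x w)).
have half u v : adj u v -> u \in X -> v \in X.
  rewrite !inE => uv Xu; apply: contraT; rewrite negb_or => /andP[vx vy].
  have neq (a b c : G) : adj a c -> ~~ adj b c -> a != b.
    by move=> ac; apply: contraNneq => <-.
  have ux : u != x.
    by rewrite eq_sym; apply: contraTneq uv => <-; rewrite adj_sym.
  have uy : u != y.
    by rewrite eq_sym; apply: contraTneq uv => <-; rewrite adj_sym.
  have vu : v != u by apply: contraTneq uv => ->; rewrite adj_irr.
  have xv : x != v by apply: neq xy vy.
  have yv : y != v by apply: (neq y v x) => //; rewrite adj_sym.
  have ne_xy : x != y by apply: contraTneq xy => ->; rewrite adj_irr.
  have un : uniq [:: v; u; x; y].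
    by rewrite /= !inE !negb_or vu ux uy ne_xy !(eq_sym v) xv yv.
  have un' : uniq [:: v; u; y; x].
    by rewrite /= !inE !negb_or vu ux uy (eq_sym y) ne_xy !(eq_sym v) xv yv.
  have [ax|nax] := boolP (adj u x); have [ay|nay] := boolP (adj u y).
  - case: (noK _ un); rewrite /relmat /= !adj_irr (adj_sym y x) (adj_sym v u)
      (adj_sym x v) (adj_sym x u) (adj_sym y v) (adj_sym y u).
    by rewrite uv ax ay xy (negPf vx) (negPf vy).
  - case: (noP _ un); rewrite /relmat /= !adj_irr (adj_sym y x) (adj_sym v u)
      (adj_sym x v) (adj_sym x u) (adj_sym y v) (adj_sym y u).
    by rewrite uv ax (negPf nay) xy (negPf vx) (negPf vy).
  - case: (noP _ un'); rewrite /relmat /= !adj_irr (adj_sym y x) (adj_sym v u)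
      (adj_sym x v) (adj_sym x u) (adj_sym y v) (adj_sym y u).
    by rewrite uv ay (negPf nax) xy (negPf vx) (negPf vy).
  by rewrite (negPf nax) (negPf nay) in Xu.
move=> u v uv; apply/idP/idP; apply: half => //; by rewrite adj_sym.
Qed.

(** A part with one vertex has no inner pair, so its sign may be changed. *)
Lemma mixlab_sign (G : sgraph) t t' (h : G -> nat) : mixlab t h ->
  size t' = size t ->
  (forall i, (i < size t)%N ->
    t'`_i = t`_i \/ (absz t`_i = 1%N /\ absz t'`_i = 1%N)) ->
  mixlab t' h.
Proof.
move=> [h_lt h_card h_adj] st tt'; split; rewrite ?st //.
  by move=> i lti; rewrite h_card //; case: (tt' i lti) => [->|[-> ->]].
move=> x y xy; rewrite h_adj //; have [hxy|//] := eqVneq (h x) (h y).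
have [-> //|[t1 _]] := tt' _ (h_lt x).
have : (1 < #|[pred z | h z == h x]|)%N.
  by apply/card_gt1P; exists x, y; rewrite !inE ?hxy eqxx.
by rewrite h_card // t1.
Qed.

(** Needed because the arithmetic yields types in both directions along the path. *)
Lemma mixlab_rev (G : sgraph) t (h : G -> nat) : mixlab t h ->
  mixlab (rev t) (fun x => size t - (h x).+1)%N.
Proof.
move=> [h_lt h_card h_adj].
have inj x i : (i < size t)%N ->
    (size t - (h x).+1 == size t - i.+1)%N = (h x == i).
  by move=> lti; have := h_lt x; lia.
split; rewrite ?size_rev.
- by move=> x; have := h_lt x; lia.
- move=> i; rewrite -[size t]/(size t) => lti.
  rewrite nth_rev // -h_card; last by rewrite ltn_subrL; case: (size t) lti.
  apply: eq_card => x; rewrite !inE -[size t]/(size t); have := h_lt x => ltx.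
  by apply/eqP/eqP => e; lia.
move=> x y xy; rewrite inj // h_adj //; case: eqP => [_|_].
  have ltx := h_lt x; rewrite nth_rev -[size t]/(size t); last by lia.
  by congr (0 < _`__); lia.
have := h_lt x; have := h_lt y; rewrite /padj -[size t]/(size t).
move: (h x) (h y) (size t) => a b k lbk lak.
by apply/orP/orP=> -[/eqP e|/eqP e]; [right|left|right|left]; apply/eqP; lia.
Qed.

(* A single vertex counts as a clique. *)
Definition sign_type (n : nat) (s : bool) : int :=
  if s || (n == 1%N) then n%:Z else - n%:Z.

Lemma labelling_mixlab (G : sgraph) k (h : G -> nat) (s : nat -> bool) :
  (forall x, (h x < k)%N) ->
  (forall x y, h x != h y -> adj x y = padj (h x) (h y)) ->
  (forall x y, x != y -> h x = h y -> adj x y = s (h x)) ->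
  mixlab (mkseq (fun i => sign_type #|[pred x | h x == i]| (s i)) k) h.
Proof.
move=> h_lt h_ne h_eq; split; rewrite ?size_mkseq //.
  by move=> i lti; rewrite nth_mkseq // /sign_type; case: ifP; rewrite ?abszN.
move=> x y xy; have [hxy|/h_ne//] := eqVneq (h x) (h y).
rewrite h_eq // nth_mkseq //.
have c1 : (1 < #|[pred z | h z == h x]|)%N.
  by apply/card_gt1P; exists x, y; rewrite !inE ?hxy eqxx.
rewrite /sign_type (gtn_eqF c1) orbF; case: (s _); lia.
Qed.

Lemma induced_or (G : sgraph) (F : seq (seq bool)) :
  (exists2 s : seq G, uniq s & relmat (@adj G) s = F) \/
  (forall s : seq G, uniq s -> relmat (@adj G) s <> F).
Proof.
have [/existsP[s /andP[us /eqP eF]]|none] := boolP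
  [exists s : (size F).-tuple G, uniq s && (relmat (@adj G) s == F)].
  by left; exists s.
right=> s us eF; case/existsP: none.
have ss : size s == size F by rewrite -eF size_map.
by exists (Tuple ss); rewrite /= us eF eqxx.
Qed.

Lemma Gstar_tame (G : sgraph) F : in_Gstar G ->
  (forall s : seq G, uniq s -> relmat (@adj G) s <> F) -> tame G F.
Proof. by case=> _ np nl _ noF; split; rewrite ?np ?nl. Qed.

Section Forward.
Variable H : sgraph.
Hypothesis HG : in_Gstar H.

Let cH : sg_connected H. Proof. by case: HG. Qed.

Let class_gt0 (h : H -> nat) i x : h x = i -> (0 < #|[pred z | h z == i]|)%N.
Proof. by move=> hx; apply/card_gt0P; exists x; rewrite inE hx. Qed.

Lemma forward_P5 s : uniq s -> relmat (@adj H) s = path_mat 5 ->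
  exists p q r : nat, [/\ (0 < p)%N, (0 < q)%N, (0 < r)%N &
    exists h : H -> nat, mixlab [:: 1; p%:Z; - q%:Z; r%:Z; 1] h].
Proof.
move=> us sP.
have noF s' : uniq s' -> relmat (@adj H) s' <> [:: [:: true]].
  by case: s' => [|x [|y s']] //=; rewrite /relmat /= adj_irr.
have ss : size s = 5%N := size_relmat sP.
have x0 : H by case: s ss {us sP}.
have [h [sg [h_lt h_ne h_eq h_base h_out]]] :=
  labellingP x0 (Gstar_tame HG noF) cH us sP P5_check.
have cls i : (i < 5)%N -> h (nth x0 s i) = i.
  move=> lti; rewrite h_base //.
  by move: i lti; do 5! [case=> //].
have cgt0 i : (i < 5)%N -> (0 < #|[pred z | h z == i]|)%N.
  by move=> lti; apply: class_gt0 (cls i lti).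
have inb x : x \in s -> x = nth x0 s (h x).
  move=> xs; have lt5 : (index x s < 5)%N by rewrite -ss index_mem.
  by rewrite -{2}(nth_index x0 xs) cls // nth_index.
(* No pattern outside the base has label 0 or 4. *)
have single i : (i == 0%N) || (i == 4%N) -> #|[pred z | h z == i]| = 1%N.
  move=> i04; have i5 : (i < 5)%N by case/orP: i04 => /eqP->.
  apply/eqP; rewrite eqn_leq cgt0 // andbT; apply/card_le1P => x hx y.
  rewrite !inE; apply/eqP/eqP => [hy|-> //]; last exact/eqP.
  move: hx; rewrite inE => /eqP hx.
  have out z : h z = i -> z = nth x0 s i.
    move=> hz; have [/inb|/h_out[p pT [lp _]]] := boolP (z \in s).
      by rewrite hz.
    move: i04; rewrite -hz -lp; move: pT {lp}; rewrite !inE.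
    by case/or3P => /eqP->.
  by rewrite (out y hy) (out x hx).
(* A part with two vertices has one outside the base, whose pattern gives the sign. *)
have sgn i : (1 < #|[pred z | h z == i]|)%N -> sg i = (i \in [:: 1; 3]%N).
  move=> /card_gt1P[x [y]]; rewrite !inE => -[/eqP hx /eqP hy xy].
  have [z hz zs] : exists2 z, h z = i & z \notin s.
    have [xs|xs] := boolP (x \in s); last by exists x.
    exists y => //; apply: contra xy => ys.
    by rewrite (inb x xs) (inb y ys) hx hy.
  have [p pT [lp]] := h_out z zs.
  rewrite hz => <-; move: lp; rewrite hz => <-; move: pT; rewrite !inE.
  by case/or3P => /eqP->.
have := labelling_mixlab h_lt h_ne h_eq; set t := mkseq _ _ => th.
exists #|[pred z | h z == 1%N]|, #|[pred z | h z == 2%N]|,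
  #|[pred z | h z == 3%N]|.
split; rewrite ?cgt0 //; exists h; apply: mixlab_sign th _ _ => // i.
rewrite size_mkseq => lti; rewrite nth_mkseq // /sign_type.
have [ci|ci] := eqVneq #|[pred z | h z == i]| 1%N.
  right; rewrite orbT ci; split=> //.
  by move: i lti ci; do 5! [case=> [_ ci|]; first by rewrite /= ?abszN ?ci].
left; rewrite orbF; have c1 : (1 < #|[pred z | h z == i]|)%N.
  by rewrite ltn_neqAle eq_sym ci cgt0.
rewrite sgn //; move: i lti ci {c1}.
by do 5! [case=> [_ ci|]; first by rewrite //= single ?eqxx in ci *].
Qed.

(** The adjacent vertices 2 and 3 of the paw share a part, which is therefore a clique with r >= 2;
    the other two parts may have either sign, hence four types. *)
Lemma forward_paw s : uniq s -> relmat (@adj H) s = paw_mat ->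
  (forall s' : seq H, uniq s' -> relmat (@adj H) s' <> path_mat 4) ->
  exists p q r : int, [/\ 1 <= p, 1 <= q, 2 <= r &
     [\/ sg_iso H (mixed_path [tuple - p; - q; r]),
         sg_iso H (mixed_path [tuple - p; q; r]),
         sg_iso H (mixed_path [tuple p; - q; r]) |
         sg_iso H (mixed_path [tuple p; q; r])]].
Proof.
move=> us sP noP.
have ss : size s = 4%N := size_relmat sP.
have x0 : H by case: s ss {us sP}.
have [h [sg [h_lt h_ne h_eq h_base _]]] :=
  labellingP x0 (Gstar_tame HG noP) cH us sP paw_check.
have cgt0 i : (i < 3)%N -> (0 < #|[pred z | h z == i]|)%N.
  move=> lti; apply: (@class_gt0 h i (nth x0 s i)); rewrite h_base //.
    by move: i lti; do 3! [case=> //].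
  exact: leq_trans lti _.
have cd : nth x0 s 2 != nth x0 s 3 by rewrite nth_uniq ?ss.
have h2 : h (nth x0 s 2) = 2%N by rewrite h_base.
have h3 : h (nth x0 s 3) = 2%N by rewrite h_base.
have sg2 : sg 2 = true.
  have := h_eq _ _ cd; rewrite h2 h3 => /(_ erefl) <-.
  by rewrite -(entry_relmat (@adj H) x0) ?ss // sP.
have c2 : (1 < #|[pred z | h z == 2%N]|)%N.
  by apply/card_gt1P; exists (nth x0 s 2), (nth x0 s 3); rewrite !inE h2 h3.
have := labelling_mixlab h_lt h_ne h_eq; rewrite /mkseq /= sg2 => th.
exists #|[pred z | h z == 0%N]|%:Z, #|[pred z | h z == 1%N]|%:Z,
  #|[pred z | h z == 2%N]|%:Z; split; rewrite ?lez_nat ?cgt0 //.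
move: th; rewrite /sign_type /=; case: ifP => _; case: ifP => _ th.
- constructor 4; exact: mixlab_iso th.
- constructor 3; exact: mixlab_iso th.
- constructor 2; exact: mixlab_iso th.
- constructor 1; exact: mixlab_iso th.
Qed.

End Forward.

Lemma sign_typeE n s : (0 < n)%N ->
  [/\ sign_type n s != 0, absz (sign_type n s) = n,
      0 < sign_type n s -> sign_type n s = n%:Z &
      (0 < sign_type n s) = false -> sign_type n s = - n%:Z /\ (1 < n)%N].
Proof.
rewrite /sign_type => n0.
by case: ifP => [_|/norP[_ n1]]; split; rewrite ?abszN //; lia.
Qed.

(** Singularity of Q + 1 leads to (ii), that of Q to (iii) and (iv). *)
Lemma forward_P4 (H : sgraph) s : in_Gstar H ->
  uniq s -> relmat (@adj H) s = path_mat 4 ->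
  (forall s' : seq H, uniq s' -> relmat (@adj H) s' <> path_mat 5) ->
  (exists p q r : int, [/\ 1 <= p, 1 <= q, 1 <= r &
     [\/ sg_iso H (mixed_path [tuple p; - 3; - 2; - 2]),
         sg_iso H (mixed_path [tuple - 2; q; r; - 2]) |
         sg_iso H (mixed_path [tuple p; - 2; r; - 3])]])
  \/
  (exists p q r s : int,
     [/\ 1 <= r,
         (p, q, s) \in
           [:: (3, 3, 6); (3, 4, 4); (3, 6, 3); (4, 2, 6); (4, 3, 3);
               (4, 6, 2); (5, 2, 4); (5, 4, 2); (7, 2, 3); (7, 3, 2)] &
         sg_iso H (mixed_path [tuple p; q; - r; s])])
  \/
  (exists p q r s : int,
     (p, q, r, s) \in
       [:: (2, 2, 2, 7); (2, 2, 3, 4); (2, 2, 6, 3); (2, 3, 2, 5);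
           (2, 3, 4, 3); (2, 5, 2, 4); (2, 5, 3, 3); (3, 2, 2, 3)] /\
     sg_iso H (mixed_path [tuple p; q; r; s])).
Proof.
move=> HG us sP noP; have cH : sg_connected H by case: HG.
have ss : size s = 4%N := size_relmat sP.
have x0 : H by case: s ss {us sP}.
have [h [sg [h_lt h_ne h_eq h_base _]]] :=
  labellingP x0 (Gstar_tame HG noP) cH us sP P4_check.
pose n (i : nat) := #|[pred z | h z == i]|.
have n0 i : (i < 4)%N -> (0 < n i)%N.
  move=> lti; apply/card_gt0P; exists (nth x0 s i); rewrite inE h_base //.
  by move: i lti; do 4! [case=> //].
have := labelling_mixlab h_lt h_ne h_eq; set t := mkseq _ _ => th.
have tE i : (i < 4)%N -> t`_i = sign_type (n i) (sg i).
  by move=> ?; rewrite nth_mkseq.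
have tP i (lti : (i < 4)%N) := sign_typeE (sg i) (n0 i lti).
have teq : t = [:: t`_0; t`_1; t`_2; t`_3] by [].
have st : size t = 4%N by [].
clearbody t.
have t0 i : (i < 4)%N -> t`_i != 0.
  by move=> lti; rewrite tE //; case: (tP i lti).
have tn i : (i < 4)%N -> absz t`_i = n i.
  by move=> lti; rewrite tE //; case: (tP i lti).
have tpos i : (i < 4)%N -> 0 < t`_i -> t`_i = (n i)%:Z.
  by move=> lti; rewrite tE //; case: (tP i lti).
have tneg i : (i < 4)%N -> (0 < t`_i) = false ->
    t`_i = - (n i)%:Z /\ (1 < n i)%N.
  by move=> lti; rewrite tE //; case: (tP i lti).
have := rank_adjmx2_Gstar HG; rewrite (rank_adjmx2_mixlab th st t0).
move/eq_leq; rewrite rank_qmx4 // => /orP[sing|sing]; last first.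
  left; pose m i := if 0 < t`_i then 1%N else n i.
  have nd i : (i < 4)%N ->
      [/\ (0 < diag1 t i)%N, (0 < m i)%N & absz t`_i = (diag1 t i * m i)%N].
    move=> lti; rewrite /diag1 /m tn //.
    by case: ifP => _; rewrite ?n0 ?muln1 ?mul1n.
  have m1 i : (i < 4)%N -> m i = 1%N -> t`_i = (n i)%:Z.
    rewrite /m => lti; case: ifP => [ti _|ti]; first exact: tpos.
    by case: (tneg i lti ti) => _ /[swap] ->.
  have m2 i k : (i < 4)%N -> m i = k.+2 -> t`_i = - k.+2%:Z.
    rewrite /m => lti; case: ifP => // ti <-.
    by case: (tneg i lti ti).
  have := singular_diag1 sing nd; rewrite !inE.
  have rtE : rev t = [:: t`_3; t`_2; t`_1; t`_0] by rewrite {1}teq.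
  have thr := mixlab_rev th; rewrite rtE in thr; rewrite teq in th.
  case/orP => [/eqP[e0 e1 e2 e3]|].
    exists (n 0%N)%:Z, 1, 1; split; rewrite ?lez_nat ?n0 //; constructor 1.
    rewrite (m1 0%N) // (m2 1%N 1%N) // (m2 2%N 0%N) // (m2 3%N 0%N) // in th.
    exact: mixlab_iso th.
  case/orP => [/eqP[e0 e1 e2 e3]|].
    exists 1, (n 1%N)%:Z, (n 2%N)%:Z; split; rewrite ?lez_nat ?n0 //.
    constructor 2.
    rewrite (m2 0%N 0%N) // (m1 1%N) // (m1 2%N) // (m2 3%N 0%N) // in th.
    exact: mixlab_iso th.
  case/orP => [/eqP[e0 e1 e2 e3]|].
    exists (n 0%N)%:Z, 1, (n 2%N)%:Z; split; rewrite ?lez_nat ?n0 //.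
    constructor 3.
    rewrite (m1 0%N) // (m2 1%N 0%N) // (m1 2%N) // (m2 3%N 1%N) // in th.
    exact: mixlab_iso th.
  (* The last two solutions are the reversals of the first and the third. *)
  case/orP => /eqP[e0 e1 e2 e3].
    exists (n 3%N)%:Z, 1, 1; split; rewrite ?lez_nat ?n0 //; constructor 1.
    rewrite (m1 3%N) // (m2 2%N 1%N) // (m2 1%N 0%N) // (m2 0%N 0%N) // in thr.
    exact: mixlab_iso thr.
  exists (n 3%N)%:Z, 1, (n 1%N)%:Z; split; rewrite ?lez_nat ?n0 //.
  constructor 3.
  rewrite (m1 3%N) // (m2 2%N 0%N) // (m1 1%N) // (m2 0%N 1%N) // in thr.
  exact: mixlab_iso thr.
have nd (i : nat) : (i < 4)%N ->
    (0 < absz (t`_i)%R)%N /\ (diag0 t i = 0%N \/ absz t`_i = (diag0 t i).+1).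
  move=> lti; rewrite /diag0 tn //; split; first exact: n0.
  by case: ifP => _; [right; rewrite prednK ?n0|left].
have dpos (i : nat) : (i < 4)%N -> (0 < diag0 t i)%N -> t`_i = (n i)%:Z.
  by rewrite /diag0 => lti; case: ifP => // ti _; apply: tpos.
(* [diag0] also vanishes on a single vertex, whose type 1 is then rewritten as -1. *)
have dneg (i : nat) : (i < 4)%N -> diag0 t i = 0%N ->
    - (n i)%:Z = t`_i \/ (absz t`_i = 1%N /\ absz (- (n i)%:Z) = 1%N).
  rewrite /diag0 => lti; case: ifP => ti; last by left; case: (tneg i lti ti).
  by rewrite tn // abszN => n1; right; have := n0 i lti; split; lia.
have [d0 d3 mem3] := singular_diag0 sing nd.
have {d0} e0 := dpos 0%N isT d0; have {d3} e3 := dpos 3%N isT d3.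
move: mem3; rewrite !tn // => -[[d1 d2 mem]|[d2 d1 mem]|[d1 d2 mem]].
- right; left; exists (n 0%N)%:Z, (n 1%N)%:Z, (n 2%N)%:Z, (n 3%N)%:Z.
  split; rewrite ?lez_nat ?n0 //.
  apply: (@mixlab_iso _ _ _ h).
  apply: mixlab_sign th _ _; rewrite st // => i lti.
  move: i lti; case=> [|[|[|[|//]]]] _ /=; rewrite -?e0 -?e3;
    [by left| |exact: dneg|by left].
  by left; rewrite dpos.
- right; left; exists (n 3%N)%:Z, (n 2%N)%:Z, (n 1%N)%:Z, (n 0%N)%:Z.
  split; rewrite ?lez_nat ?n0 //.
  apply: (mixlab_iso (h := fun x => size t - (h x).+1)%N).
  apply: mixlab_sign (mixlab_rev th) _ _; rewrite size_rev st // => i lti.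
  rewrite nth_rev st //.
  move: i lti; case=> [|[|[|[|//]]]] _ /=; rewrite -?e0 -?e3;
    [by left| |exact: dneg|by left].
  by left; rewrite dpos.
have e1 := dpos 1%N isT d1; have e2 := dpos 2%N isT d2.
right; right.
case: mem => mem.
  exists (n 0%N)%:Z, (n 1%N)%:Z, (n 2%N)%:Z, (n 3%N)%:Z; split=> //.
  by apply: (@mixlab_iso _ _ _ h); rewrite /= -e0 -e1 -e2 -e3 -teq.
exists (n 3%N)%:Z, (n 2%N)%:Z, (n 1%N)%:Z, (n 0%N)%:Z; split=> //.
apply: (mixlab_iso (h := fun x => size t - (h x).+1)%N).
by have := mixlab_rev th; rewrite {1}teq /= e0 e1 e2 e3.
Qed.

(** * Mixed extensions of paths in G* *)

Lemma mixed_P3_Gstar (H : sgraph) (a b c : int) : a != 0 -> b != 0 -> 1 < c ->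
  sg_iso H (mixed_path [tuple a; b; c]) -> in_Gstar H.
Proof.
move=> a0 b0 c1 /iso_mixlab[h th].
have t0 i : (i < 3)%N -> [:: a; b; c]`_i != 0.
  by case: i => [|[|[|//]]] //= _; rewrite gt_eqF // (lt_trans _ c1).
apply: (mixlab_Gstar th) => //; last exact: (mixlab_pos3 th).
by rewrite (rank_adjmx2_mixlab th (erefl _) t0) rank_leq_row.
Qed.

Lemma mixed_P4_Gstar (H : sgraph) (t : 4.-tuple int) :
  (forall i, (i < 4)%N -> t`_i != 0) ->
  singular4 (fun i => absz t`_i) (diag0 t) ||
  singular4 (fun i => absz t`_i) (diag1 t) ->
  sg_iso H (mixed_path t) -> in_Gstar H.
Proof.
move=> t0 sing /iso_mixlab[h th]; have st := size_tuple t.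
have t0' i : (i < size t)%N -> t`_i != 0 by rewrite st; apply: t0.
apply: (mixlab_Gstar th); rewrite ?st //; last first.
  by apply: (mixlab_pos4 th); rewrite ?st.
by rewrite (rank_adjmx2_mixlab th st t0) rank_qmx4.
Qed.

Lemma mixed_P5_Gstar (H : sgraph) (p q r : nat) :
  (0 < p)%N -> (0 < q)%N -> (0 < r)%N ->
  sg_iso H (mixed_path [tuple 1; p%:Z; - q%:Z; r%:Z; 1]) -> in_Gstar H.
Proof.
move=> p0 q0 r0 /iso_mixlab[h th].
have t0 i : (i < 5)%N -> [:: 1; p%:Z; - q%:Z; r%:Z; 1]`_i != 0.
  by case: i => [|[|[|[|[|//]]]]] //= _; rewrite ?oppr_eq0 -lt0n.
apply: (mixlab_Gstar th) => //; last exact: (mixlab_pos4 th).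
by rewrite (rank_adjmx2_mixlab th (erefl _) t0) rank_qmx5.
Qed.

Theorem theorem7p1 (H : sgraph) :
  in_Gstar H <->
  (* (i) *)
  (exists p q r : int, [/\ 1 <= p, 1 <= q, 2 <= r &
     [\/ sg_iso H (mixed_path [tuple - p; - q; r]),
         sg_iso H (mixed_path [tuple - p; q; r]),
         sg_iso H (mixed_path [tuple p; - q; r]) |
         sg_iso H (mixed_path [tuple p; q; r])]])
  \/
  (* (ii) *)
  (exists p q r : int, [/\ 1 <= p, 1 <= q, 1 <= r &
     [\/ sg_iso H (mixed_path [tuple p; - 3; - 2; - 2]),
         sg_iso H (mixed_path [tuple - 2; q; r; - 2]) |
         sg_iso H (mixed_path [tuple p; - 2; r; - 3])]])
  \/
  (* (iii) *)
  (exists p q r s : int,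
     [/\ 1 <= r,
         (p, q, s) \in
           [:: (3, 3, 6); (3, 4, 4); (3, 6, 3); (4, 2, 6); (4, 3, 3);
               (4, 6, 2); (5, 2, 4); (5, 4, 2); (7, 2, 3); (7, 3, 2)] &
         sg_iso H (mixed_path [tuple p; q; - r; s])])
  \/
  (* (iv) *)
  (exists p q r s : int,
     (p, q, r, s) \in
       [:: (2, 2, 2, 7); (2, 2, 3, 4); (2, 2, 6, 3); (2, 3, 2, 5);
           (2, 3, 4, 3); (2, 5, 2, 4); (2, 5, 3, 3); (3, 2, 2, 3)] /\
     sg_iso H (mixed_path [tuple p; q; r; s]))
  \/
  (* (v) *)
  (exists p q r : int, [/\ 1 <= p, 1 <= q, 1 <= r &
     sg_iso H (mixed_path [tuple 1; p; - q; r; 1])]).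
Proof.
split; last first.
- case=> [[p [q [r [p1 q1 r2]]]]|].
    have [p0 q0] : p != 0 /\ q != 0 by split; lia.
    by case; apply: mixed_P3_Gstar; rewrite ?oppr_eq0.
  case=> [[[p|p] [[q|q] [[r|r] [p1 q1 r1]]]]|] //.
    case; apply: mixed_P4_Gstar.
    + by case=> [|[|[|[|//]]]] //= _; rewrite -lt0n.
    + apply/orP; right; rewrite /singular4 /diag1 /= (p1 : 0 < p%:Z).
      by apply/eqP; lia.
    + by case=> [|[|[|[|//]]]] //= _; rewrite -lt0n.
    + apply/orP; right.
      rewrite /singular4 /diag1 /= (q1 : 0 < q%:Z) (r1 : 0 < r%:Z).
      by apply/eqP; nia.
    + by case=> [|[|[|[|//]]]] //= _; rewrite -lt0n.
    + apply/orP; right.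
      rewrite /singular4 /diag1 /= (p1 : 0 < p%:Z) (r1 : 0 < r%:Z).
      by apply/eqP; nia.
  case=> [[p [q [[r|r] [s [r1 mem]]]]]|] //.
    have r0 : (0 < - r%:Z) = false by rewrite oppr_gt0.
    have rn : r != 0%N by rewrite -lt0n.
    apply: mixed_P4_Gstar.
      have [pn qn sn] : [/\ p != 0, q != 0 & s != 0].
        move: mem; rewrite !inE.
        by do 9! [case/orP => [/eqP[-> -> ->] //|]] => /eqP[-> -> ->].
      by case=> [|[|[|[|//]]]] //= _; rewrite oppr_eq0.
    apply/orP; left; rewrite /singular4 /diag0 /= r0 abszN absz_nat.
    move: mem; rewrite !inE.
    do 9! [case/orP => [/eqP[-> -> ->]|]; first by apply/eqP => /=; lia].
    by move=> /eqP[-> -> ->]; apply/eqP => /=; lia.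
  case=> [[p [q [r [s [mem]]]]]|].
    apply: mixed_P4_Gstar; move: mem; rewrite !inE.
      do 7! [case/orP => [/eqP[-> -> -> ->]|]; first by case=> [|[|[|[|//]]]]].
      by move=> /eqP[-> -> -> ->]; case=> [|[|[|[|//]]]].
    by do 7! [case/orP => [/eqP[-> -> -> ->] //|]] => /eqP[-> -> -> ->].
  by case=> [[p|p] [[q|q] [[r|r] [p1 q1 r1]]]] //; apply: mixed_P5_Gstar.
move=> HG.
have [[s us sP]|noP5] := induced_or H (path_mat 5).
  have [p [q [r [p0 q0 r0 [h th]]]]] := forward_P5 HG us sP.
  do 4! right; exists p%:Z, q%:Z, r%:Z; split=> //; exact: mixlab_iso th.
have [[s us sP]|noP4] := induced_or H (path_mat 4).
  have [iso|[iso|iso]] := forward_P4 HG us sP noP5; first by right; left.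
    by right; right; left.
  by do 3! right; left.
have [[s us sP]|noK] := induced_or H paw_mat.
  by left; exact: (forward_paw HG us sP noP4).
have [cH pos2 _ _] := HG.
by have := multipartite_pos (paw_path_free cH noP4 noK); rewrite pos2.
Qed.
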